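(* Any nonadaptive unateness tester (even with two-sided error) for real-valued functions $f:[n]^d\to\mathbb{R}$ with distance parameter $\varepsilon=1/8$ must make $\Omega(d(\log n+\log d))$ queries.
   Context: A function $f:[n]^d\to\mathbb{R}$ is unate if for every coordinate $i\in[d]$ it is nonincreasing or nondecreasing in the $i$-th coordinate; $f$ is $\varepsilon$-far from unate if at least an $\varepsilon$ fraction of its values must be changed to make it unate. A tester with distance parameter $\varepsilon$ must accept unate functions with probability at least $2/3$ and reject functions $\varepsilon$-far from unate with probability at least $2/3$; it is nonadaptive if all its queries are chosen before any answers are seen. *)

(* Defs.v *)
From HB Require Import structures.
From mathcomp Require Import all_boot all_order all_algebra.
From mathcomp Require Import all_classical all_reals all_analysis.
Set Implicit Arguments.
Unset Strict Implicit.
Unset Printing Implicit Defensive.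
Import Order.TTheory GRing.Theory Num.Theory.
Local Open Scope classical_set_scope.
Local Open Scope ring_scope.

Definition grid (n d : nat) : finType := {ffun 'I_d -> 'I_n}.

Section Unateness.
Variables (R : realType) (n d : nat).
Implicit Types (f g : grid n d -> R) (i : 'I_d) (x y : grid n d).

Definition agree_off i x y : Prop := forall j, j != i -> x j = y j.

Definition nondecreasing_in f i : Prop :=
  forall x y, agree_off i x y -> (x i <= y i)%N -> f x <= f y.

Definition nonincreasing_in f i : Prop :=
  forall x y, agree_off i x y -> (x i <= y i)%N -> f y <= f x.

Definition unate f : Prop :=
  forall i, nonincreasing_in f i \/ nondecreasing_in f i.

Definition far_from_unate (eps : R) f : Prop :=
  forall g, unate g ->
    eps * #|grid n d|%:R <= #|[set x : grid n d | f x != g x]%SET|%:R.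

End Unateness.

(* All the randomness is in the sample point w : Omega, on an arbitrary
   probability space.  Nonadaptivity is the fact that [queries w] does not
   depend on the input function; the verdict may use w as well as the answers.
   Repeated queries are allowed, so q is an upper bound on the number of
   distinct points queried. *)
Record nonadaptive_algorithm (R : realType) (n d q : nat) := NonadaptiveAlgorithm {
  disp : measure_display;
  Omega : measurableType disp;
  prob : probability Omega R;
  queries : Omega -> q.-tuple (grid n d);
  verdict : Omega -> q.-tuple R -> bool;
  measurable_queries :
    forall s : q.-tuple (grid n d), measurable [set w | queries w = s];
  measurable_verdict :
    forall a : q.-tuple R, measurable [set w | verdict w a]
}.

Section Tester.
Variables (R : realType) (n d q : nat) (A : nonadaptive_algorithm R n d q).

Definition accepts (f : grid n d -> R) (w : Omega A) : bool :=
  verdict w (map_tuple f (queries w)).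

Definition nonadaptive_unateness_tester (eps : R) : Prop :=
  (forall f, unate f ->
     ((2 / 3)%:E <= prob A [set w | accepts f w])%E) /\
  (forall f, far_from_unate eps f ->
     ((2 / 3)%:E <= prob A [set w | ~~ accepts f w])%E).

End Tester.

(* Main.v *)
Require Import Defs.
From HB Require Import structures.
From mathcomp Require Import all_boot all_order all_algebra.
From mathcomp Require Import all_classical all_reals all_analysis.
From mathcomp Require Import zify ring lra.
Import Order.TTheory GRing.Theory Num.Theory.
Import numFieldNormedType.Exports.
Local Open Scope ring_scope.
Set Implicit Arguments.
Unset Strict Implicit.
Unset Printing Implicit Defensive.

(** Only the order of the answers can help a tester. Relabel the values of the
    input by phi_0 < phi_1 < ... and let these tend to infinity one after the
    other along an ultrafilter: the acceptance probability becomes a sum, over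
    the finitely many query tuples, of terms that depend only on the order of
    the input on the tuple. This replaces the usual Ramsey argument.

    If n >= d, compare the lexicographic function with the functions obtained
    from it by flipping bit j of coordinate i. The two are ordered alike on the
    queries unless two queries have (i, j) as the first position where they
    differ; q points have fewer than q such branching positions, and there are
    about d log n pairs (i, j).

    If d > n, use a family of distributions, one for each scale m = 2^k with
    k up to (log d)/4. The first half of the coordinates selects one of 2m
    classes. A random set T of m hidden coordinates is drawn from the other
    half; each hidden coordinate i is visible in two random classes only, with
    a random sign, and the two signs agree in the unate function and disagree
    in the far one. Elsewhere the functions are lexicographic. To tell them
    apart, the queries must branch at some hidden i in both of its classes.
    If the queries branch at i in t_i classes, scale k succeeds with probability
    about (1/d) sum_i min(m, t_i)^2 / m, and the sum over k of this is O(q/d),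
    whereas every scale must succeed with constant probability. Ignoring T
    creates additional branchings, but each of them can be charged to a query
    that takes the minority side of a branching at some coordinate of T; a
    query does so at no more than log q coordinates, few of which lie in T. *)

(** * Reduction to order-invariant testers *)

Section GeneralizedLimit.
Variable R : realType.

Definition between (u : nat -> R) (B : R) : Prop := forall n, 0 <= u n <= B.

(** A limit at infinity for bounded sequences, in the manner of a Banach limit. Lower bounds count
    as soon as they hold eventually; this is how values are sent to infinity one after the other. *)
Definition generalized_limit (l : (nat -> R) -> R) : Prop :=
  [/\ forall u v B, between u B -> between v B ->
        l (fun n => u n + v n) = l u + l v,
      forall c, l (fun=> c) = c,
      forall u B c N, between u B -> (forall n, (N <= n)%N -> c <= u n) ->
        c <= l u
    & forall u B c, between u B -> (forall n, u n <= c) -> l u <= c].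

(** By compactness the image filter clusters at some [p]. An ultrafilter contains the preimage of a
    neighbourhood of [p] or its complement, and clustering excludes the complement. *)
Lemma ultrafilter_cvg {G : set_system nat} {u : nat -> R} {B : R} :
  UltraFilter G -> between u B -> cvg (u x @[x --> G])%classic.
Proof.
move=> GU uB; have GP : ProperFilter G by exact: ultra_proper.
have GB : G (u @^-1` `[0, B])%classic.
  by apply: filterE => n; rewrite /= in_itv /=; exact: uB.
have [p [_ pcl]] := segment_compact (fmap_proper_filter u GP) GB.
apply/cvg_ex; exists p => V Vp.
have [//|GV] := @in_ultra_setVsetC _ G (u @^-1` V)%classic GU.
by have [x [/= nVx Vx]] := pcl (~` V)%classic V GV Vp.
Qed.

Lemma generalized_limit_exists : exists l, generalized_limit l.
Proof.
have [G [GU sG]] := ultraFilterLemma (eventually_filter : ProperFilter \oo%classic).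
have GP : ProperFilter G by exact: ultra_proper.
exists (fun u => lim (u x @[x --> G])%classic); split.
- move=> u v B uB vB; have cu := ultrafilter_cvg GU uB.
  by have cv := ultrafilter_cvg GU vB; apply: limD.
- by move=> c; apply: cvg_lim => //; apply: cvg_cst.
- move=> u B c N uB ge; apply: limr_ge; first exact: ultrafilter_cvg uB.
  by apply: sG; exists N.
- move=> u B c uB le; apply: limr_le; first exact: ultrafilter_cvg uB.
  exact: nearW.
Qed.

End GeneralizedLimit.

(** * Iterated limits in increasing variables *)

Section IteratedLimit.
Variables (R : realType) (l : (nat -> R) -> R).
Hypothesis hl : generalized_limit l.

Let lD := let: And4 H _ _ _ := hl in H.
Let lc := let: And4 _ H _ _ := hl in H.
Let l_ge := let: And4 _ _ H _ := hl in H.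
Let l_le := let: And4 _ _ _ H := hl in H.

(** The head of the sequence is the outermost variable: each entry tends to infinity while the
    earlier ones stay fixed. *)
Fixpoint iterlim (N : nat) (P : seq nat -> R) : R :=
  if N is M.+1 then l (fun a => iterlim M (fun s => P (a :: s))) else P [::].

Lemma iterlim_between N P B :
  (forall s, 0 <= P s <= B) -> 0 <= iterlim N P <= B.
Proof.
elim: N P => [|N IH] P PB //=.
have bt : between (fun a => iterlim N (fun s => P (a :: s))) B by move=> a; exact: IH.
apply/andP; split; first by apply: (l_ge (N := 0) bt) => n _; case/andP: (bt n).
by apply: (l_le bt) => n; case/andP: (bt n).
Qed.

Lemma iterlimD N P Q B : (forall s, 0 <= P s <= B) -> (forall s, 0 <= Q s <= B) ->
  iterlim N (fun s => P s + Q s) = iterlim N P + iterlim N Q.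
Proof.
elim: N P Q => [|N IH] P Q PB QB //=.
rewrite -(lD (B := B)).
- by congr l; apply/funext => a; exact: IH.
- by move=> a; exact: iterlim_between.
- by move=> a; exact: iterlim_between.
Qed.

Lemma iterlim_cst N c : iterlim N (fun=> c) = c.
Proof. by elim: N => [|N IH] //=; under [X in l X]eq_fun do rewrite IH; exact: lc. Qed.

Lemma iterlim_sum N (I : eqType) (r : seq I) (P : I -> seq nat -> R) :
  (forall i s, 0 <= P i s <= 1) ->
  iterlim N (fun s => \sum_(i <- r) P i s) = \sum_(i <- r) iterlim N (P i).
Proof.
move=> PB; elim: r => [|i r IH].
  by under [X in iterlim _ X]eq_fun do rewrite big_nil; rewrite big_nil iterlim_cst.
under [X in iterlim _ X]eq_fun do rewrite big_cons; rewrite big_cons -IH.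
apply: (@iterlimD _ _ _ (1 + (size r)%:R)) => s.
  have /andP[-> h] := PB i s; apply: le_trans h _; by rewrite lerDl.
apply/andP; split; first by apply: sumr_ge0 => j _; case/andP: (PB j s).
apply: (@le_trans _ _ (\sum_(j <- r) 1)); first by apply: ler_sum => j _; case/andP: (PB j s).
by rewrite big_const_seq count_predT iter_addr_0 lerDr.
Qed.

Lemma iterlim_ge N P B c k : (forall s, 0 <= P s <= B) ->
  (forall s, size s = N -> sorted ltn s -> all (fun a => (k <= a)%N) s -> c <= P s) ->
  c <= iterlim N P.
Proof.
elim: N P k => [|N IH] P k PB Pc /=; first exact: Pc.
apply: (l_ge (B := B) (N := k)) => [a|a ka]; first exact: iterlim_between.
(* The later variables may be taken above [a]; this makes the sequences under test strictly
   increasing. *)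
apply: (IH _ a.+1) => // s sN ss sa; apply: Pc => /=; first by rewrite sN.
  by rewrite path_sortedE ?sa //; exact: ltn_trans.
by rewrite ka; apply: sub_all sa => b; apply: leq_trans; apply: leq_trans ka _.
Qed.

(* Coordinates in [D] already have the value [al]; the others still wait for
   their limit variable, so only the order type of [r] off [D] matters. *)
Lemma iterlim_order_type q (F : {ffun 'I_q -> nat} -> R) k N N' (D : pred 'I_q)
    (al r r' : 'I_q -> nat) :
  (N + N' <= k)%N ->
  (forall i, ~~ D i -> (r i < N)%N) -> (forall i, ~~ D i -> (r' i < N')%N) ->
  (forall i j, ~~ D i -> ~~ D j -> (r i <= r j)%N = (r' i <= r' j)%N) ->
  iterlim N (fun s => F [ffun i => if D i then al i else nth 0%N s (r i)]) =
  iterlim N' (fun s => F [ffun i => if D i then al i else nth 0%N s (r' i)]).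
Proof.
elim: k N N' D al r r' => [|k IH] N N' D al r r' Nk rN rN' rr.
  have D1 i : D i by apply/negPn/negP => /rN; lia.
  have -> : N = 0%N by lia.
  have -> /= : N' = 0%N by lia.
  by congr F; apply/ffunP => i; rewrite !ffunE D1.
(* If no waiting coordinate uses the outermost variable, the outer limit is that of a constant. *)
have drop M (t : 'I_q -> nat) : (forall i, ~~ D i -> (0 < t i)%N) ->
    iterlim M.+1 (fun s => F [ffun i => if D i then al i else nth 0%N s (t i)]) =
    iterlim M (fun s => F [ffun i => if D i then al i else nth 0%N s (t i).-1]).
  move=> t0 /=; rewrite -[RHS]lc; congr l; apply/funext => a; congr iterlim.
  apply/funext => s; congr F; apply/ffunP => i; rewrite !ffunE.
  by case: ifPn => // /t0; case: (t i).
case: (boolP [exists i, ~~ D i && (r i == 0%N)]) => [|/existsPn r0]; last first.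
  have {}r0 i : ~~ D i -> (0 < r i)%N by move=> Di; move: (r0 i); rewrite Di lt0n.
  case: N Nk rN => [|N] Nk rN; last first.
    have Nk' : (N + N' <= k)%N by lia.
    rewrite drop //; apply: IH => //.
    - by move=> i Di; move: (rN i Di) (r0 i Di); lia.
    - move=> i j Di Dj; rewrite -(rr _ _ Di Dj).
      by move: (r0 i Di) (r0 j Dj); lia.
  have D1 i : D i by apply/negPn/negP => /rN.
  rewrite /= -[LHS](iterlim_cst N'); congr iterlim; apply/funext => s; congr F.
  by apply/ffunP => i; rewrite !ffunE D1.
move=> /existsP[i0 /andP[Di0 /eqP ri0]].
case: (boolP [exists i, ~~ D i && (r' i == 0%N)]) => [|/existsPn r0]; last first.
  have {}r0 i : ~~ D i -> (0 < r' i)%N by move=> Di; move: (r0 i); rewrite Di lt0n.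
  case: N' Nk rN' => [|N'] Nk rN'; first by move: (rN' _ Di0).
  have Nk' : (N + N' <= k)%N by lia.
  rewrite drop //; apply: IH => //.
  - by move=> i Di; move: (rN' i Di) (r0 i Di); lia.
  - move=> i j Di Dj; rewrite (rr _ _ Di Dj).
    by move: (r0 i Di) (r0 j Dj); lia.
move=> /existsP[i1 /andP[Di1 /eqP ri1]].
(* Both sides now have coordinates waiting for the outermost variable. Agreement of the orders makes
   them the same coordinates, so the same value [a] can be fixed on both sides. *)
have r0E i : ~~ D i -> (r i == 0%N) = (r' i == 0%N).
  move=> Di; rewrite -!leqn0 -{1}ri0 -ri1 (rr _ _ Di Di0).
  apply/idP/idP => h; last by apply: leq_trans h _; rewrite ri1.
  by apply: leq_trans h _; rewrite -(rr _ _ Di0 Di1) ri0.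
case: N Nk rN => [|N] Nk rN; first by move: (rN _ Di0).
case: N' Nk rN' => [|N'] Nk rN'; first by move: (rN' _ Di0).
rewrite /=; congr l; apply/funext => a.
pose D2 i := D i || (r i == 0%N); pose al2 i := if D i then al i else a.
have step M (t : 'I_q -> nat) : (forall i, ~~ D i -> (r i == 0%N) = (t i == 0%N)) ->
    iterlim M (fun s => F [ffun i => if D i then al i else nth 0%N (a :: s) (t i)]) =
    iterlim M (fun s => F [ffun i => if D2 i then al2 i else nth 0%N s (t i).-1]).
  move=> tE; congr iterlim; apply/funext => s; congr F; apply/ffunP => i.
  by rewrite !ffunE /D2 /al2; case: ifPn => //= /tE ->; case: (t i).
rewrite (step _ r) // (step _ r') //; apply: IH; first by move: Nk; lia.
- by move=> i; rewrite negb_or => /andP[Di ri]; move: (rN _ Di); lia.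
- move=> i; rewrite negb_or => /andP[Di]; rewrite (r0E _ Di) => ri.
  by move: (rN' _ Di); lia.
- move=> i j; rewrite !negb_or => /andP[Di ri] /andP[Dj rj].
  have := ri; have := rj; rewrite (r0E _ Di) (r0E _ Dj) => ri' rj'.
  by move: (rr _ _ Di Dj); lia.
Qed.

End IteratedLimit.

(** * Testers that see only the order of the values *)

Section ComparisonBased.
Variables (R : realType) (n d : nat).
Implicit Types f g : grid n d -> R.

Definition same_order f g : Prop := forall x y, (f x <= f y) = (g x <= g y).

Definition same_order_on q (s : q.-tuple (grid n d)) f g : Prop :=
  forall i j, (f (tnth s i) <= f (tnth s j)) = (g (tnth s i) <= g (tnth s j)).

Lemma same_order_unate f g : same_order f g -> unate g -> unate f.
Proof.
move=> fg ug i; case: (ug i) => h; [left|right] => x y xy le; rewrite fg; exact: h.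
Qed.

(** Tied points share a rank, so comparing ranks is comparing values, and every increasing
    relabelling of the ranks keeps the order of [g]. *)
Definition rank g (x : grid n d) : nat := #|[set y | (g y < g x)%R]%SET|.

Lemma rank_lt g x : (rank g x < #|grid n d|)%N.
Proof.
rewrite -cardsT; apply: proper_card; apply/properP; split; first exact: finset.subsetT.
by exists x; rewrite ?inE ?ltxx.
Qed.

Lemma rank_le g x y : (rank g x <= rank g y)%N = (g x <= g y).
Proof.
case: (leP (g x) (g y)) => h.
  by apply: subset_leq_card; apply/fintype.subsetP => z; rewrite !inE => /lt_le_trans; apply.
apply/negbTE; rewrite -ltnNge; apply: proper_card; apply/properP; split.
  by apply/fintype.subsetP => z; rewrite !inE => /lt_trans; apply.
by exists y; rewrite !inE ?ltxx.
Qed.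

Lemma same_order_reval g (s : seq nat) : size s = #|grid n d| -> sorted ltn s ->
  same_order (fun x => (nth 0%N s (rank g x))%:R) g.
Proof.
move=> sN ss x y; rewrite ler_nat -rank_le.
apply: (leq_mono_in (f := nth 0%N s) (D := [pred i | (i < size s)%N])).
- exact: (sorted_ltn_nth ltn_trans 0%N ss).
- by rewrite inE sN rank_lt.
- by rewrite inE sN rank_lt.
Qed.

(** [mu] is the distribution of the query tuple and [Q s g] the probability of asking [s] and
    accepting. Rejection presupposes that all functions ordered like [g] are far, because [Q] arises
    from relabelled copies of [g]. *)
Definition order_invariant_tester q (mu : q.-tuple (grid n d) -> R)
    (Q : q.-tuple (grid n d) -> (grid n d -> R) -> R) : Prop :=
  [/\ \sum_s mu s = 1,
      forall s g, 0 <= Q s g <= mu s,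
      forall s g g', same_order_on s g g' -> Q s g = Q s g',
      forall g, unate g -> 2 / 3 <= \sum_s Q s g
    & forall g, (forall f, same_order f g -> far_from_unate (1 / 8) f) ->
        \sum_s Q s g <= 1 / 3].

Section FromTester.
Variables (q : nat) (A : nonadaptive_algorithm R n d q).

Let T := q.-tuple (grid n d).

Let qset (s : T) : set (Omega A) := [set w | queries w = s]%classic.
Let aset (s : T) (a : q.-tuple R) : set (Omega A) :=
  (qset s `&` [set w | verdict w a])%classic.

Let m_qset s : measurable (qset s).
Proof. exact: measurable_queries. Qed.

Let m_aset s a : measurable (aset s a).
Proof. by apply: measurableI; [exact: m_qset|exact: measurable_verdict]. Qed.

Definition query_prob (s : T) : R := fine (prob A (qset s)).
Definition accept_prob (s : T) (a : q.-tuple R) : R := fine (prob A (aset s a)).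

Lemma accept_prob_between s a : 0 <= accept_prob s a <= query_prob s.
Proof.
rewrite fine_ge0 //= fine_le ?fin_num_measure //.
by apply: le_measure; rewrite ?inE //; exact: subIsetl.
Qed.

Lemma query_prob_le1 s : query_prob s <= 1.
Proof. by rewrite -lee_fin fineK ?fin_num_measure // probability_le1. Qed.

Lemma prob_partition (V : T -> set (Omega A)) : (forall s, measurable (V s)) ->
  (forall s, V s `<=` qset s)%classic ->
  fine (prob A (\bigcup_s V s)%classic) = \sum_s fine (prob A (V s)).
Proof.
move=> mV VQ; rewrite measure_fin_bigcup //=.
- rewrite fsbig_finite; last exact: finite_finset.
  transitivity (fine (\sum_s prob A (V s))%E); last first.
    by symmetry; apply: sum_fine => s _; exact: fin_num_measure.
  congr fine; symmetry; rewrite (bigID [pred s | true]) /= [X in _ + X]big_pred0 //.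
  rewrite addr0; apply: perm_big; apply: uniq_perm.
  + exact: index_enum_uniq.
  + exact: finmap.fset_uniq.
  + move=> s; rewrite mem_index_enum; symmetry.
    by have := in_fset_set (finite_finset : finite_set [set: T]%classic) s; rewrite in_setT.
- move=> s t _ _ [w [Vs Vt]].
  by rewrite -(VQ _ _ Vs) -(VQ _ _ Vt).
Qed.

Lemma sum_query_prob : \sum_s query_prob s = 1.
Proof.
rewrite -(prob_partition m_qset); last by move=> s.
rewrite (_ : (\bigcup_s _)%classic = setT) ?probability_setT //.
by apply/seteqP; split => // w _; exists (queries w).
Qed.

Lemma prob_accepts g :
  fine (prob A [set w | accepts g w]%classic) =
  \sum_s accept_prob s (map_tuple g s).
Proof.
rewrite -(prob_partition (V := fun s => aset s (map_tuple g s))) //; last first.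
  by move=> s; exact: subIsetl.
congr (fine (prob A _)); apply/seteqP; split => w /=.
  by move=> acc; exists (queries w).
by case=> s _ [<-].
Qed.

Lemma measurable_accepts g : measurable [set w : Omega A | accepts g w]%classic.
Proof.
rewrite (_ : mkset _ = (\bigcup_s aset s (map_tuple g s))%classic).
  by apply: fin_bigcup_measurable => //; exact: finite_finset.
apply/seteqP; split => w /=; first by move=> acc; exists (queries w).
by case=> s _ [<-].
Qed.

Lemma order_invariant_of_tester : nonadaptive_unateness_tester A (1 / 8) ->
  exists mu Q, @order_invariant_tester q mu Q.
Proof.
move=> [acc rej]; have [l hl] := generalized_limit_exists R.
pose F (s : T) (v : {ffun 'I_q -> nat}) := accept_prob s [tuple (v i)%:R | i < q].
pose N := #|grid n d|.
pose P (s : T) g (ph : seq nat) := F s [ffun i => nth 0%N ph (rank g (tnth s i))].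
have PE s g ph : P s g ph =
    accept_prob s (map_tuple (fun x => (nth 0%N ph (rank g x))%:R) s).
  rewrite /P /F; congr accept_prob; apply: eq_from_tnth => i.
  by rewrite tnth_mktuple ffunE tnth_map.
have Pq s g ph : 0 <= P s g ph <= query_prob s by rewrite PE; exact: accept_prob_between.
have P1 s g ph : 0 <= P s g ph <= 1.
  by have /andP[-> h] := Pq s g ph; exact: le_trans h (query_prob_le1 s).
have sumP g ph : \sum_s P s g ph =
    fine (prob A [set w | accepts (fun x => (nth 0%N ph (rank g x))%:R) w]%classic).
  by rewrite prob_accepts; apply: eq_bigr => s _; exact: PE.
(* Rejection is a lower bound on the complementary mass; in this form [iterlim_ge] treats far inputs
   like unate ones. *)
have sumq g : \sum_s (query_prob s - iterlim l N (P s g)) =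
    iterlim l N (fun ph => \sum_s (query_prob s - P s g ph)).
  rewrite iterlim_sum // => [|s ph]; last first.
    have /andP[a b] := Pq s g ph; have := query_prob_le1 s; lra.
  apply: eq_bigr => s _; apply/eqP; rewrite subr_eq; apply/eqP.
  rewrite -(@iterlimD _ _ hl _ _ _ 1) // => [|ph].
    rewrite -[LHS](iterlim_cst hl N); congr iterlim; apply/funext => ph; ring.
  have /andP[a b] := Pq s g ph; have := query_prob_le1 s; lra.
exists query_prob, (fun s g => iterlim l N (P s g)); split.
- exact: sum_query_prob.
- by move=> s g; apply: iterlim_between.
- move=> s g g' gg'.
  have E h : iterlim l N (P s h) = iterlim l N (fun ph =>
     F s [ffun i => if pred0 i then 0%N else nth 0%N ph (rank h (tnth s i))]) by [].
  rewrite !E; apply: (@iterlim_order_type _ _ hl _ (F s) (N + N) N N pred0 (fun=> 0%N)) => //.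
  + by move=> i _; exact: rank_lt.
  + by move=> i _; exact: rank_lt.
  + by move=> i j _ _; rewrite !rank_le gg'.
- move=> g ug; rewrite -(iterlim_sum hl) //.
  apply: (@iterlim_ge _ _ hl N _ #|{: q.-tuple (grid n d)}|%:R _ 0%N) => [ph|ph phN phs _].
    apply/andP; split; first by apply: sumr_ge0 => s _; case/andP: (P1 s g ph).
    by rewrite -sum1_card natr_sum; apply: ler_sum => s _; case/andP: (P1 s g ph).
  rewrite sumP -lee_fin fineK ?fin_num_measure //; last exact: measurable_accepts.
  apply: acc; exact: (same_order_unate (same_order_reval g phN phs) ug).
- move=> g far.
  suff : 2 / 3 <= \sum_s (query_prob s - iterlim l N (P s g)).
    by rewrite sumrB sum_query_prob; lra.
  rewrite sumq.
  apply: (@iterlim_ge _ _ hl N _ #|{: q.-tuple (grid n d)}|%:R _ 0%N) => [ph|ph phN phs _].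
    have h s : 0 <= query_prob s - P s g ph <= 1.
      have /andP[a b] := Pq s g ph; have := query_prob_le1 s; lra.
    apply/andP; split; first by apply: sumr_ge0 => s _; case/andP: (h s).
    by rewrite -sum1_card natr_sum; apply: ler_sum => s _; case/andP: (h s).
  rewrite sumrB sum_query_prob sumP.
  have mA := measurable_accepts (fun x => (nth 0%N ph (rank g x))%:R).
  have := rej _ (far _ (same_order_reval g phN phs)).
  have -> : [set w | ~~ accepts (fun x => (nth 0%N ph (rank g x))%:R) w]%classic =
      (~` [set w : Omega A | accepts (fun x => (nth 0%N ph (rank g x))%:R : R) w])%classic.
    by apply/seteqP; split => w /= /negP.
  by rewrite probability_setC // -[X in (_ - X)%E]fineK ?fin_num_measure.
Qed.

End FromTester.
End ComparisonBased.

(** * Branching positions of a set of queries *)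

Lemma sum_card_pairs (P Z : finType) (f : P -> Z -> bool) :
  (\sum_p \sum_z f p z = #|[set iz : P * Z | f iz.1 iz.2]|)%N.
Proof.
rewrite pair_bigA /= -sum1_card [RHS]big_mkcond /=; apply: eq_bigr => iz _.
by rewrite inE; case: f.
Qed.

Section Capture.
Variables (X P Z : finType) (key : P -> nat) (v : X -> P -> nat) (cls : X -> Z).
Hypothesis key_inj : injective key.
Implicit Types (s : seq X) (i p : P) (T : pred P) (z : Z).
Local Open Scope nat_scope.

(* Positions with a smaller [key] are more significant. *)
Definition captured s T i z : bool :=
  ~~ T i && [exists x : X, exists y : X, [&& x \in s, y \in s, cls x == z, cls y == z,
    v x i != v y i & [forall p : P, (key p < key i) ==> ~~ T p ==> (v x p == v y p)]]].

Lemma capturedP s T i z :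
  reflect (~~ T i /\ exists x y, [/\ x \in s, y \in s, cls x = z /\ cls y = z,
      v x i <> v y i & forall p, key p < key i -> ~~ T p -> v x p = v y p])
    (captured s T i z).
Proof.
apply: (iffP andP) => -[Ti].
  move=> /existsP[x /existsP[y /and5P[xs ys /eqP xz /eqP yz /andP[/eqP n /forallP h]]]].
  split=> //; exists x, y; split=> // p pi Tp.
  by apply/eqP; move: (h p); rewrite pi Tp.
move=> [x [y [xs ys [xz yz] n h]]]; split=> //.
apply/existsP; exists x; apply/existsP; exists y.
rewrite xs ys xz yz eqxx /=; apply/andP; split; first exact/eqP.
by apply/forallP => p; apply/implyP => pi; apply/implyP => Tp; rewrite h.
Qed.

Lemma captured_sub s s' T i z : {subset s <= s'} -> captured s T i z -> captured s' T i z.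
Proof.
move=> ss /capturedP[Ti [x [y [xs ys xy n h]]]]; apply/capturedP; split=> //.
by exists x, y; split=> //; exact: ss.
Qed.

Lemma captured_cons_new s T a i z : captured (a :: s) T i z -> ~~ captured s T i z ->
  [/\ ~~ T i, z = cls a & exists2 y, y \in s & [/\ cls y = z, v a i <> v y i
    & forall p, key p < key i -> ~~ T p -> v a p = v y p]].
Proof.
move=> /capturedP[Ti [x [y [xs ys [xz yz] n h]]]] /capturedP nc; split=> //.
  move: xs ys; rewrite !inE => /orP[/eqP <- //|xs] /orP[/eqP <- //|ys].
  by case: nc; split=> //; exists x, y.
move: xs ys; rewrite !inE => /orP[/eqP xa|xs] /orP[/eqP ya|ys].
- by case: n; rewrite xa ya.
- by exists y => //; rewrite -xa.
- exists x; first by [].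
  by rewrite -ya; split=> // [|p pi Tp]; [exact/nesym | rewrite h].
- by case: nc; split=> //; exists x, y.
Qed.

(* The new point [a] shares a strictly longer prefix with one of its two
   partners, and these two partners already capture the other position. *)
Lemma captured_cons_uniq s T a i z i' z' :
  captured (a :: s) T i z -> ~~ captured s T i z ->
  captured (a :: s) T i' z' -> ~~ captured s T i' z' -> (i, z) = (i', z').
Proof.
wlog le_ii' : i z i' z' / key i <= key i'.
  move=> W c n c' n'; case: (leqP (key i) (key i')) => [/W|/ltnW/W] h; first exact: h.
  by rewrite (h _ _ c' n' c n).
move=> c n c' n'.
have [Ti zE [y ys [yz ny hy]]] := captured_cons_new c n.
have [Ti' zE' [y' ys' [yz' ny' hy']]] := captured_cons_new c' n'.
case: (ltngtP (key i) (key i')) le_ii' => // [lt_ii'|/key_inj ->] _; last by rewrite zE zE'.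
case/negP: n; apply/capturedP; split=> //; exists y, y'; split=> //.
- by rewrite yz yz' zE.
- by rewrite -(hy' i) //; exact/nesym.
- by move=> p pi Tp; rewrite -hy // hy' //; exact: ltn_trans lt_ii'.
Qed.

(** By [captured_cons_uniq] each added query creates at most one new captured pair. *)
Lemma card_captured_cat s s' T :
  #|[set iz : P * Z | captured (s' ++ s) T iz.1 iz.2 && ~~ captured s T iz.1 iz.2]|
    <= size s'.
Proof.
elim: s' => [|a s' IH] /=.
  by rewrite leqn0 cards_eq0; apply/eqP/finset.setP => iz; rewrite !inE andbN.
pose N := [set iz : P * Z | captured (a :: s' ++ s) T iz.1 iz.2
                            && ~~ captured (s' ++ s) T iz.1 iz.2].
have N1 : #|N| <= 1.
  apply/card_le1P => -[i z]; rewrite !inE /= => /andP[c n] [i' z'].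
  rewrite !inE /=; apply/idP/eqP => [/andP[c' n']|[-> ->]].
    by symmetry; exact: (captured_cons_uniq c n c' n').
  by rewrite c n.
apply: leq_trans (leq_add N1 IH); apply: leq_trans (leq_card_setU _ _).
apply: subset_leq_card; apply/fintype.subsetP => iz; rewrite !inE => /andP[c n].
by rewrite c n andbT; case: (captured (s' ++ s) T iz.1 iz.2).
Qed.

Lemma card_captured s T : #|[set iz : P * Z | captured s T iz.1 iz.2]| <= size s.
Proof.
have := card_captured_cat [::] s T; rewrite cats0; apply: leq_trans.
apply: subset_leq_card; apply/fintype.subsetP => iz; rewrite !inE => ->.
by apply/capturedP => -[_ [x [y []]]].
Qed.

(** * Minority sides of branchings *)

Section Minority.
Variable s : seq X.
Hypothesis v01 : forall x p, v x p < 2.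

Definition branch x p : pred X :=
  fun y => (cls y == cls x) && [forall p', (key p' < key p) ==> (v y p' == v x p')].

(** Ties go to 0, so in either case the opposite side holds at most half of the branch. *)
Definition majority x p : bool :=
  count (branch x p) s < 2 * count (fun y => branch x p y && (v y p == 1)) s.

Definition minority x p : bool := v x p != majority x p.

Lemma branch_eq x y p : branch x p y -> branch x p =1 branch y p.
Proof.
move=> /andP[/eqP c /forallP h] u; rewrite /branch c; congr (_ && _).
apply: eq_forallb => p'; case: ltnP => //= k.
by move: (h p'); rewrite k /= => /eqP ->.
Qed.

Lemma majority_eq x y p : branch x p y -> majority x p = majority y p.
Proof.
by move=> /branch_eq E; rewrite /majority (eq_count E);
  congr (_ < 2 * _); apply: eq_count => u; rewrite E.
Qed.

Lemma minority_halves x p : minority x p ->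
  2 * count (fun y => branch x p y && (v y p == v x p)) s <= count (branch x p) s.
Proof.
rewrite /minority; case M : (majority x p); move: M; rewrite /majority => M n.
  have -> : v x p = 0 by move: (v01 x p) n; case: (v x p) => [|[]].
  have E r : count (branch x p) r = count (fun y => branch x p y && (v y p == 1)) r
      + count (fun y => branch x p y && (v y p == 0)) r.
    elim: r => //= y r ->; move: (v01 y p); case: (branch x p y) => //=.
    by case: (v y p) => [|[|k]] //= _; lia.
  by move: M; rewrite E; lia.
have -> : v x p = 1 by move: (v01 x p) n; case: (v x p) => [|[]].
by rewrite leqNgt M.
Qed.

(** Reading positions by increasing key, the set of queries that agree with [x] so far shrinks, and
    at least halves wherever [x] takes the minority side. Injectivity of [key] means at most one
    position per step. *)
Lemma minority_exp x N : x \in s ->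
  2 ^ #|[set p | minority x p && (key p < N)]|
    * count (fun y => (cls y == cls x) && [forall p, (key p < N) ==> (v y p == v x p)]) s
  <= size s.
Proof.
move=> xs; elim: N => [|N IH].
  rewrite (_ : [set p | _] = finset.set0); last by apply/finset.setP => p; rewrite !inE andbF.
  by rewrite cards0 mul1n count_size.
set m := #|_| in IH; set c := count _ _ in IH.
set m' := #|_|; set c' := count _ _.
have c'c : c' <= c.
  apply: sub_count => y /andP[-> /forallP h]; apply/forallP => p; apply/implyP => pN.
  by apply: (implyP (h p)); exact: ltnW.
have [/existsP[p /andP[mp /eqP kp]]|/existsPn no] :=
    boolP [exists p, minority x p && (key p == N)].
  have m'E : m' <= m.+1.
    rewrite -[m.+1]addn1 -(cards1 p) /m /m'; apply: leq_trans (leq_card_setU _ _).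
    apply: subset_leq_card; apply/fintype.subsetP => p'; rewrite !inE => /andP[-> /=].
    rewrite ltnS leq_eqVlt => /orP[/eqP k|-> //]; apply/orP; right; apply/eqP.
    by apply: key_inj; rewrite k kp.
  have c'E : 2 * c' <= c.
    rewrite (_ : c = count (branch x p) s); last by rewrite /c /branch kp.
    apply: leq_trans (minority_halves mp); rewrite leq_mul2l /=; apply: sub_count => y.
    move=> /andP[cy /forallP h]; rewrite /branch cy /=; apply/andP; split.
      apply/forallP => p'; apply/implyP => pp; apply: (implyP (h p')).
      by apply: leq_trans pp _; rewrite kp.
    by apply: (implyP (h p)); rewrite kp.
  apply: leq_trans IH; apply: (@leq_trans (2 ^ m.+1 * c')).
    by rewrite leq_mul2r leq_pexp2l ?orbT.
  by rewrite expnS mulnAC mulnC leq_mul2l c'E orbT.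
have -> : m' = m.
  rewrite /m /m'; apply: eq_card => p; rewrite !inE ltnS leq_eqVlt.
  by move: (no p); case: minority => //= /negbTE ->.
by apply: leq_trans IH; rewrite leq_mul2l c'c orbT.
Qed.

Lemma card_minority x : x \in s -> 2 ^ #|[set p | minority x p]| <= size s.
Proof.
move=> xs; have [N kN] : exists N, forall p, key p < N.
  exists (\max_p key p).+1 => p; rewrite ltnS; exact: leq_bigmax.
apply: leq_trans (minority_exp N xs); rewrite -[X in X <= _]muln1.
rewrite (eq_card (B := [set p | minority x p && (key p < N)])) => [|p]; last first.
  by rewrite !inE kN andbT.
rewrite leq_mul2l -has_count; apply/orP; right; apply/hasP; exists x => //.
by rewrite eqxx; apply/forallP => p; rewrite eqxx implybT.
Qed.

(** Two queries that follow the majority on [T] and agree off [T] before [i] also agree on [T]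
    there: as long as they agree they lie in one branch and see the same majority. *)
Lemma captured_majority T i z :
  captured [seq x <- s | [forall p, T p ==> ~~ minority x p]] T i z ->
  captured s pred0 i z.
Proof.
move=> /capturedP[Ti [x [y [+ + [xz yz] n h]]]].
rewrite !mem_filter => /andP[/forallP mx xs] /andP[/forallP my ys].
apply/capturedP; split=> //; exists x, y; split=> // p pi _.
suff: forall N p, key p < N -> key p < key i -> v x p = v y p by apply; first exact: ltnSn.
clear p pi; elim=> // N IH p; rewrite ltnS => pN pi.
case: (boolP (T p)) => [Tp|]; last exact: h.
have B : branch x p y.
  rewrite /branch xz yz eqxx; apply/forallP => p'; apply/implyP => pp.
  by rewrite IH //; [exact: leq_trans pp pN | exact: ltn_trans pi].
move: (mx p) (my p); rewrite Tp /minority (majority_eq B) => /=.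
by move=> /negPn/eqP -> /negPn/eqP ->.
Qed.

(** By [captured_majority] the queries that follow the majority on [T] contribute no excess pair;
    adding the others back costs one pair each. *)
Lemma card_captured_excess T :
  #|[set iz : P * Z | captured s T iz.1 iz.2 && ~~ captured s pred0 iz.1 iz.2]|
    <= count (fun x => [exists p, T p && minority x p]) s.
Proof.
pose good x := [forall p, T p ==> ~~ minority x p].
have -> : count (fun x => [exists p, T p && minority x p]) s = size [seq x <- s | predC good x].
  rewrite size_filter; apply: eq_count => x /=; rewrite negb_forall.
  by apply: eq_existsb => p; rewrite negb_imply negbK.
apply: leq_trans (card_captured_cat [seq x <- s | good x] _ T).
apply: subset_leq_card; apply/fintype.subsetP => iz; rewrite !inE => /andP[c n].
apply/andP; split; last by apply: contra n; exact: captured_majority.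
apply: captured_sub c => x xs; rewrite mem_cat !mem_filter xs !andbT /=.
by case: (good x).
Qed.

End Minority.
End Capture.

(** * Lexicographic sums and distance to unateness *)

Section LexicographicSum.
Variable R : realDomainType.

(** Geometric series with weights [b ^+ D] down to [b]: the sum stays below the next weight
    [b ^+ D.+1]. *)
Lemma lex_sum_bound (b : R) D (e : 'I_D -> R) : 1 <= b ->
  (forall p, `|e p| <= b - 1) ->
  `|\sum_p e p * b ^+ (D - p)| <= b ^+ D.+1 - b.
Proof.
move=> b1; elim: D e => [|D IH] e eb; first by rewrite big_ord0 normr0 expr1 subrr.
rewrite big_ord_recl subn0; apply: le_trans (ler_normD _ _) _.
have tail : `|\sum_(i < D) e (lift ord0 i) * b ^+ (D.+1 - lift ord0 i)| <= b ^+ D.+1 - b.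
  by apply: (IH (fun i => e (lift ord0 i))).
have b0 : 0 <= b ^+ D.+1 by rewrite exprn_ge0 // (le_trans ler01).
have head : `|e ord0 * b ^+ D.+1| <= (b - 1) * b ^+ D.+1.
  by rewrite normrM (ger0_norm b0) ler_wpM2r.
by apply: le_trans (lerD head tail) _; rewrite [b ^+ D.+2]exprS; lra.
Qed.

(** The first nonzero digit outweighs the tail by [lex_sum_bound], so the sign of the sum is decided
    there. *)
Lemma lex_sum_sign (b : R) D (e e' : 'I_D -> R) : 1 < b ->
  (forall p, `|e p| <= b - 1) -> (forall p, `|e' p| <= b - 1) ->
  (forall p, e p = 0 \/ 1 <= `|e p|) -> (forall p, e' p = 0 \/ 1 <= `|e' p|) ->
  (forall p : 'I_D, (forall p' : 'I_D, (p' < p)%N -> e p' = 0) -> Num.sg (e p) = Num.sg (e' p)) ->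
  (\sum_p e p * b ^+ (D - p) <= 0) = (\sum_p e' p * b ^+ (D - p) <= 0).
Proof.
move=> b1; have bW := ltW b1.
elim: D e e' => [|D IH] e e' eb eb' e1 e1' ee'; first by rewrite !big_ord0.
have s0 : Num.sg (e ord0) = Num.sg (e' ord0) by apply: ee'.
pose t (f : 'I_D.+1 -> R) := \sum_(i < D) f (lift ord0 i) * b ^+ (D.+1 - lift ord0 i).
have tb f : (forall p, `|f p| <= b - 1) -> `|t f| <= b ^+ D.+1 - b.
  by move=> fb; apply: (lex_sum_bound (e := fun i => f (lift ord0 i))).
have bD : 0 < b ^+ D.+1 by rewrite exprn_gt0 // (lt_trans ltr01).
have pos f : (forall p, `|f p| <= b - 1) -> 1 <= f ord0 -> 0 < f ord0 * b ^+ D.+1 + t f.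
  move=> /tb /ler_normlP[h _] f1; have : b ^+ D.+1 <= f ord0 * b ^+ D.+1.
    by rewrite ler_peMl // ltW.
  by lra.
have neg f : (forall p, `|f p| <= b - 1) -> f ord0 <= -1 -> f ord0 * b ^+ D.+1 + t f < 0.
  move=> /tb /ler_normlP[_ h] f1; have : f ord0 * b ^+ D.+1 <= - b ^+ D.+1.
    by rewrite -mulN1r ler_wpM2r // ltW.
  by lra.
rewrite ![\sum_(p < D.+1) _]big_ord_recl !subn0 -/(t e) -/(t e').
case: (ltrgt0P (e ord0)) => e0.
- have e'0 : 0 < e' ord0 by rewrite -sgr_gt0 -s0 sgr_gt0.
  have := pos _ eb; have := pos _ eb'.
  case: (e1 ord0) (e1' ord0) => [?|+] [?|+]; [lra|lra|lra|].
  rewrite !gtr0_norm // => h h' /(_ h') p' /(_ h) p.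
  by rewrite leNgt p leNgt p'.
- have e'0 : e' ord0 < 0 by rewrite -sgr_lt0 -s0 sgr_lt0.
  have := neg _ eb; have := neg _ eb'.
  case: (e1 ord0) (e1' ord0) => [?|+] [?|+]; [lra|lra|lra|].
  rewrite !ltr0_norm // => h h' /(_ ltac:(lra)) p' /(_ ltac:(lra)) p.
  by rewrite !ltW.
- have e'0 : e' ord0 = 0 by apply/eqP; rewrite -sgr_eq0 -s0 e0 sgr0.
  rewrite e0 e'0 !mul0r !add0r; apply: (IH _ _) => // p h.
  apply: ee' => p'; case: (unliftP ord0 p') => [k ->|-> //] /=.
  by rewrite /bump /= !add1n ltnS; exact: h.
Qed.

Lemma sgr_natB (a b c k : nat) : (a < b)%N = (c < k)%N -> (b < a)%N = (k < c)%N ->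
  Num.sg (a%:R - b%:R : R) = Num.sg (c%:R - k%:R).
Proof.
case: (ltngtP a b); case: (ltngtP c k) => // h1 h2 _ _.
- by rewrite !ltr0_sg // subr_lt0 ltr_nat.
- by rewrite !gtr0_sg // subr_gt0 ltr_nat.
- by rewrite h1 h2 !subrr.
Qed.

Lemma normr_natB_le (a b k : nat) : (a < k)%N -> (b < k)%N ->
  `|a%:R - b%:R : R| <= k%:R - 1.
Proof.
move=> ak bk; have := ler0n R a; have := ler0n R b.
have : a.+1%:R <= k%:R :> R by rewrite ler_nat.
have : b.+1%:R <= k%:R :> R by rewrite ler_nat.
by rewrite -!natr1 => ? ? ? ?; apply/ler_normlP; split; lra.
Qed.

Lemma normr_natB_ge1 (a b : nat) : (a%:R - b%:R : R) = 0 \/ 1 <= `|a%:R - b%:R : R|.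
Proof.
case: (ltngtP a b) => [h|h|->]; last by left; rewrite subrr.
  right; rewrite distrC ger0_norm ?subr_ge0 ?ler_nat 1?ltnW // lerBrDr nat1r ler_nat //.
by right; rewrite ger0_norm ?subr_ge0 ?ler_nat 1?ltnW // lerBrDr nat1r ler_nat.
Qed.

End LexicographicSum.

(** * Distance to unateness by disjoint pairs *)

Section FarCounting.
Variables (R : realType) (n d : nat).

(** In each pair [x], [sh x] some value must change. The pairs are disjoint, so choosing one changed
    point per pair is injective. *)
Lemma far_of_pairs (f : grid n d -> R) :
  (forall g : grid n d -> R, unate g -> exists (S : {set grid n d}) (sh : grid n d -> grid n d),
     [/\ {in S &, injective sh}, forall x, x \in S -> sh x \notin S,
         forall x, x \in S -> f x <> g x \/ f (sh x) <> g (sh x)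
       & (n ^ d <= 8 * #|S|)%N]) ->
  far_from_unate (1 / 8) f.
Proof.
move=> H g /H[S [sh [shI shS fg cS]]].
pose t x := if f x != g x then x else sh x.
have tI : {in S &, injective t}.
  move=> x y xS yS; rewrite /t; case: ifP => _; case: ifP => _ // E.
  - by move: xS; rewrite E (negPf (shS _ yS)).
  - by move: yS; rewrite -E (negPf (shS _ xS)).
  - exact: shI.
have le : (#|S| <= #|[set x | f x != g x]%SET|)%N.
  rewrite -(card_in_imset tI); apply: subset_leq_card.
  apply/fintype.subsetP => _ /finset.imsetP[x xS ->]; rewrite inE /t.
  case: ifPn => // /negPn/eqP fx; case: (fg _ xS) => [//|]; by move/eqP.
rewrite card_ffun !card_ord mul1r mulrC ler_pdivrMr ?ltr0n // -natrM ler_nat mulnC.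
by apply: leq_trans cS _; rewrite leq_mul2l.
Qed.

Lemma card_cylinder (K : nat) (i : 'I_d) (y : grid n d) (A : pred 'I_n) : (K <= i)%N ->
  (n * #|[set x : grid n d | A (x i) && [forall j : 'I_d, (j < K) ==> (x j == y j)]]%SET|
   = #|A| * n ^ (d - K))%N.
Proof.
move=> Ki; pose F (j : 'I_d) : pred 'I_n := fun k =>
  if (j < K)%N then k == y j else (j == i) ==> A k.
rewrite (eq_card (B := mem (family F))); last first.
  move=> x; rewrite inE; apply/andP/familyP => [[Ax /forallP h] j|h].
    rewrite unfold_in /F; case: ltnP => [jK|jK]; first by have := h j; rewrite jK.
    by apply/implyP => /eqP ->.
  split; first by have := h i; rewrite unfold_in /F ltnNge Ki eqxx.
  by apply/forallP => j; apply/implyP => jK; have := h j; rewrite unfold_in /F jK.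
rewrite card_family foldrE big_map big_enum /= (bigD1 i) //=.
have -> : #|F i| = #|A| by apply: eq_card => k; rewrite unfold_in /F ltnNge Ki eqxx.
rewrite mulnCA; congr (_ * _)%N.
transitivity (\prod_(j < d) (if (K <= j)%N then n else 1))%N.
  rewrite [RHS](bigD1 i) //= Ki; congr (_ * _)%N; apply: eq_bigr => j ji.
  rewrite leqNgt; case: ltnP => jK /=.
    by rewrite -(card1 (y j)); apply: eq_card => k; rewrite unfold_in /F jK.
  by rewrite -[RHS]card_ord; apply: eq_card => k; rewrite unfold_in /F ltnNge jK (negPf ji).
rewrite -(big_mkord xpredT (fun j => if (K <= j)%N then n else 1%N)).
rewrite (@big_cat_nat _ _ _ K) //=; last by apply: leq_trans Ki _; exact: ltnW.
rewrite big_nat big1 ?mul1n => [|j /andP[_ jK]]; last by rewrite leqNgt jK.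
by rewrite (eq_big_nat _ _ (F2 := fun=> n)) ?prod_nat_const_nat // => j /andP[-> _].
Qed.

End FarCounting.

(** * The bound d log n *)

Section BitFlip.
Local Open Scope nat_scope.

Definition flip (j x : nat) : nat := if odd (x %/ 2 ^ j) then x - 2 ^ j else x + 2 ^ j.

Lemma divn_pow2S j x : x %/ 2 ^ j.+1 = (x %/ 2 ^ j)./2.
Proof. by rewrite expnSr divnMA divn2. Qed.

Lemma flip_div j x : flip j x %/ 2 ^ j.+1 = x %/ 2 ^ j.+1.
Proof.
have p0 : 0 < 2 ^ j by rewrite expn_gt0.
rewrite !divn_pow2S /flip; case: ifPn => o.
  rewrite divnB // modnn divnn p0 /= subn0.
  by move: (x %/ 2 ^ j) o => [|y] //=; rewrite subSS subn0 uphalfE /= => /negPf; lia.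
by rewrite divnDr // divnn p0 addn1 /=; move: (x %/ 2 ^ j) o; lia.
Qed.

Lemma flip_add j x : ~~ odd (x %/ 2 ^ j) -> flip j (x + 2 ^ j) = x.
Proof.
move=> o; have p0 : 0 < 2 ^ j by rewrite expn_gt0.
by rewrite /flip divnDr // divnn p0 addn1 /= o addnK.
Qed.

Lemma flip_addS j x : flip j (x + 2 ^ j.+1) = flip j x + 2 ^ j.+1.
Proof.
have p0 : 0 < 2 ^ j by rewrite expn_gt0.
rewrite /flip expnS divnDr ?dvdn_mull // mulnK // addn2 /= negbK.
case: ifPn => o; last by rewrite addnAC.
have : 2 ^ j <= x by case: leqP => // h; rewrite divn_small in o.
by lia.
Qed.

(** The hypothesis excludes the pairs whose highest differing bit is [j]. Otherwise a higher bit
    decides, or both numbers have the same bit [j] and move by the same amount. *)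
Lemma flip_lt j x y : ~~ ((x %/ 2 ^ j.+1 == y %/ 2 ^ j.+1) && (x %/ 2 ^ j != y %/ 2 ^ j)) ->
  (flip j x < flip j y) = (x < y).
Proof.
have lt_div a b : a %/ 2 ^ j.+1 < b %/ 2 ^ j.+1 -> a < b.
  by rewrite !ltnNge; apply: contra; exact: leq_div2r.
rewrite negb_and negbK; case: (ltngtP (x %/ 2 ^ j.+1) (y %/ 2 ^ j.+1)) => [h|h|_] /=.
- by move=> _; rewrite (lt_div x y) // (lt_div (flip j x) (flip j y)) // !flip_div.
- have := lt_div y x h; have : flip j y < flip j x by apply: lt_div; rewrite !flip_div.
  by case: ltngtP => // _ _; case: ltngtP.
move=> /eqP E'; rewrite /flip E'; case: ifPn => o; last by rewrite ltn_add2r.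
have l u : odd (u %/ 2 ^ j) -> 2 ^ j <= u.
  by move=> o'; case: leqP => // h; rewrite divn_small in o'.
have := l _ o; have := l x; rewrite E' => /(_ o); lia.
Qed.

Lemma card_even_block j n : 2 ^ j.+1 <= n ->
  n <= 4 * #|[pred y : 'I_n | ~~ odd (y %/ 2 ^ j) && (y + 2 ^ j < n)]|.
Proof.
move=> jn; set A := [pred y : 'I_n | _]; pose t := 2 ^ j; pose u := n %/ (2 * t).
have t0 : 0 < t by rewrite expn_gt0.
have lt_n (a : 'I_u) (b : 'I_t) : a * (2 * t) + b + t < n.
  have au := ltn_ord a; have bt := ltn_ord b.
  have h : u * (2 * t) <= n by exact: leq_trunc_div.
  have : a.+1 * (2 * t) <= u * (2 * t) by rewrite leq_mul2r au orbT.
  by lia.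
have lt_n' (a : 'I_u) (b : 'I_t) : a * (2 * t) + b < n.
  by apply: leq_ltn_trans (lt_n a b); rewrite leq_addr.
pose f (ab : 'I_u * 'I_t) : 'I_n := Ordinal (lt_n' ab.1 ab.2).
have fI : injective f.
  move=> [a b] [a' b'] /(congr1 val) /= E.
  have := congr1 (divn^~ (2 * t)) E; have := congr1 (modn^~ (2 * t)) E.
  have lt2 (c : 'I_t) : c < 2 * t by apply: leq_trans (ltn_ord c) _; rewrite leq_pmull.
  rewrite !modnMDl !modn_small ?lt2 // !divnMDl ?muln_gt0 // !divn_small ?lt2 // !addn0.
  by move=> /val_inj -> /val_inj ->.
have sub : #|[seq f ab | ab : 'I_u * 'I_t]| <= #|A|.
  apply: subset_leq_card; apply/fintype.subsetP => y /mapP[[a b] _ ->].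
  rewrite inE /= -/t lt_n andbT mulnA divnMDl // divn_small ?addn0 //.
  by rewrite oddM andbF.
have nE : n = u * (2 * t) + n %% (2 * t) by exact: divn_eq.
move: sub; rewrite fintype.card_image // card_prod !card_ord => sub.
have h : n %% (2 * t) < 2 * t by rewrite ltn_mod muln_gt0.
have u1 : 0 < u by rewrite divn_gt0 ?muln_gt0 // -expnS.
(* With [u >= 1] complete double blocks, [n < (u + 1) * 2 * t <= 4 * u * t]. *)
by move: sub; nia.
Qed.

End BitFlip.

Section Shift.
Variables (n d : nat).

(** Where [x i + t] leaves the range, the default of [insubd] keeps the coordinate unchanged. *)
Definition shift (i : 'I_d) (t : nat) (x : grid n d) : grid n d :=
  [ffun k => if k == i then insubd (x i) (x i + t)%N else x k].

Lemma shift_at i t (x : grid n d) : (x i + t < n)%N -> shift i t x i = (x i + t)%N :> nat.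
Proof. by move=> h; rewrite ffunE eqxx val_insubd h. Qed.

Lemma shift_off i t (x : grid n d) : agree_off i x (shift i t x).
Proof. by move=> j /negPf ji; rewrite ffunE ji. Qed.

Lemma shift_eq i t (x y : grid n d) : (x i + t < n)%N -> (y i + t < n)%N ->
  shift i t x = shift i t y -> x = y.
Proof.
move=> hx hy E; apply/ffunP => j; have := congr1 (fun f : grid n d => f j) E.
case: (eqVneq j i) => [->|ji]; last by rewrite -!(shift_off _ _ ji).
by move=> /(congr1 val) /=; rewrite !shift_at // => /addIn /val_inj.
Qed.

End Shift.

Section LexicographicFunction.
Variables (R : realType) (n d b : nat).
Implicit Types (x y : grid n d) (h : 'I_d -> nat -> nat).

Definition lexval h x : R := \sum_i (h i (x i))%:R * b%:R ^+ (d - i).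

Lemma lexval_off h i x y : (0 < b)%N -> agree_off i x y ->
  (lexval h x <= lexval h y) = (h i (x i) <= h i (y i))%N.
Proof.
move=> b0 xy; rewrite /lexval (bigD1 i) //= [X in _ <= X](bigD1 i) //=.
rewrite (eq_bigr (fun k => (h k (y k))%:R * b%:R ^+ (d - k))) => [|k ki]; last by rewrite xy.
by rewrite lerD2r ler_pM2r ?exprn_gt0 ?ltr0n // ler_nat.
Qed.

Lemma lexval_unate h : (0 < b)%N -> (forall i, {homo h i : u v / (u <= v)%N}) ->
  unate (lexval h).
Proof. by move=> b0 hm i; right=> x y xy le; rewrite (lexval_off _ b0 xy) hm. Qed.

Lemma lexval_le h h' x y : (1 < b)%N ->
  (forall i (z : grid n d), (h i (z i) < b)%N) -> (forall i (z : grid n d), (h' i (z i) < b)%N) ->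
  (forall i : 'I_d, (forall k : 'I_d, (k < i)%N -> h k (x k) = h k (y k)) ->
     (h i (x i) < h i (y i))%N = (h' i (x i) < h' i (y i))%N /\
     (h i (y i) < h i (x i))%N = (h' i (y i) < h' i (x i))%N) ->
  (lexval h x <= lexval h y) = (lexval h' x <= lexval h' y).
Proof.
move=> b1 hb hb' hh; rewrite -[LHS]subr_le0 -[RHS]subr_le0 /lexval -!sumrB.
under eq_bigr do rewrite -mulrBl; under [in RHS]eq_bigr do rewrite -mulrBl.
apply: lex_sum_sign.
- by rewrite ltr1n.
- by move=> p; exact: normr_natB_le.
- by move=> p; exact: normr_natB_le.
- by move=> p; exact: normr_natB_ge1.
- by move=> p; exact: normr_natB_ge1.
- move=> p e; have [|l1 l2] := hh p; last exact: sgr_natB.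
  by move=> k /e /eqP; rewrite subr_eq0 eqr_nat => /eqP.
Qed.

End LexicographicFunction.

(** * Lexicographic functions with one flipped bit *)

Section BitLowerBound.
Variables (R : realType) (n d : nat).
Implicit Types x y : grid n d.

Definition base_digits : 'I_d -> nat -> nat := fun=> id.
Definition flipped_digits (i : 'I_d) (j : nat) : 'I_d -> nat -> nat :=
  fun k => if k == i then flip j else id.

(** Flipping bit [j] can push a digit past [n], but not past [2 * n] when [2 ^ j <= n]; hence the
    base. *)
Local Notation f0 := (lexval R (2 * n) base_digits).
Local Notation f1 i j := (lexval R (2 * n) (flipped_digits i j)).

(** Along coordinate [i], steps of [2 ^ j] from points with bit [j] zero go down, while steps of
    [2 ^ j.+1] go up. Whatever direction [g] has, one kind contradicts it. Starting in even blocks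
    and ending in odd ones keeps the pairs disjoint. *)
Lemma flipped_far i j (f : grid n d -> R) : (2 ^ j.+2 <= n)%N ->
  same_order f (f1 i j) -> far_from_unate (1 / 8) f.
Proof.
move=> jn fo; have n0 : (0 < 2 * n)%N by rewrite muln_gt0 (leq_trans _ jn) // expn_gt0.
have jn' : (2 ^ j.+1 <= n)%N by apply: leq_trans jn; rewrite leq_exp2l.
have fE x y : agree_off i x y -> (f x <= f y) = (flip j (x i) <= flip j (y i))%N.
  by move=> xy; rewrite fo (lexval_off _ _ n0 xy) /flipped_digits eqxx.
have even_pairs k g : (2 ^ k.+1 <= n)%N ->
    (forall x, ~~ odd (x i %/ 2 ^ k) -> (x i + 2 ^ k < n)%N ->
       f x <> g x \/ f (shift i (2 ^ k) x) <> g (shift i (2 ^ k) x)) ->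
    exists (S : {set grid n d}) sh, [/\ {in S &, injective sh}, forall x, x \in S -> sh x \notin S,
      forall x, x \in S -> f x <> g x \/ f (sh x) <> g (sh x) & (n ^ d <= 8 * #|S|)%N].
  move=> kn fg; pose A := [pred y : 'I_n | ~~ odd (y %/ 2 ^ k) && (y + 2 ^ k < n)%N].
  exists [set x : grid n d | A (x i)]%SET, (shift i (2 ^ k)); split.
  - by move=> x y; rewrite !inE => /andP[_ hx] /andP[_ hy]; exact: shift_eq.
  - move=> x; rewrite !inE => /andP[ev hx]; rewrite shift_at //.
    by rewrite divnDr // divnn expn_gt0 addn1 /= ev.
  - by move=> x; rewrite inE => /andP[ev hx]; exact: fg.
  - have n1 : (0 < n)%N by apply: leq_trans kn; rewrite expn_gt0.
    pose x0 : grid n d := [ffun=> Ordinal n1].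
    have := card_cylinder x0 A (leq0n i); have := card_even_block kn; rewrite -/A.
    rewrite (eq_card (B := mem [set x : grid n d | A (x i)]%SET)) => [|x]; last first.
      rewrite [RHS]inE inE (_ : [forall _, _] = true) ?andbT //.
      exact/forallP.
    rewrite subn0 => h1 h2; rewrite -(leq_pmul2l n1) mulnCA h2.
    rewrite mulnA leq_mul2r; apply/orP; right.
    by apply: leq_trans h1 _; rewrite leq_mul2r orbT.
apply: far_of_pairs => g ug; case: (ug i) => ui.
- apply: (even_pairs j.+1) => // x ev hx.
  have xy := @shift_off n d i (2 ^ j.+1)%N x; set y := shift _ _ x in xy *.
  have yE : y i = (x i + 2 ^ j.+1)%N :> nat by exact: shift_at.
  case: (eqVneq (f x) (g x)) => [fx|/eqP]; last by left.
  right=> fy; have := ui _ _ xy; rewrite yE leq_addr => /(_ isT).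
  have yx : agree_off i y x by move=> k /xy.
  rewrite -fx -fy fE // yE flip_addS; apply/negP; rewrite -ltnNge -addn1 leq_add2l.
  by rewrite expn_gt0.
- apply: (even_pairs j) => // x ev hx.
  have xy := @shift_off n d i (2 ^ j)%N x; set y := shift _ _ x in xy *.
  have yE : y i = (x i + 2 ^ j)%N :> nat by exact: shift_at.
  case: (eqVneq (f x) (g x)) => [fx|/eqP]; last by left.
  right=> fy; have := ui _ _ xy; rewrite yE leq_addr => /(_ isT).
  rewrite -fx -fy fE // yE flip_add // /flip (negPf ev); apply/negP.
  rewrite -ltnNge -addn1 leq_add2l.
  by rewrite expn_gt0.
Qed.

Variable J : nat.
Hypothesis Jn : (2 ^ J.+1 <= n)%N.

Definition bit_key (ij : 'I_d * 'I_J) : nat := (ij.1 * J + (J.-1 - ij.2))%N.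
(** The whole number above the cut, not a single bit; it includes the bits from [J] upwards, which
    have no position of their own. *)
Definition bit_val (x : grid n d) (ij : 'I_d * 'I_J) : nat := (x ij.1 %/ 2 ^ ij.2)%N.

Local Notation bit_captured s := (captured bit_key bit_val (fun=> tt) s pred0).

Lemma bit_key_inj : injective bit_key.
Proof.
move=> [i j] [i' j'] /= E.
have lt (k : 'I_J) : (J.-1 - k < J)%N by have := ltn_ord k; lia.
have := congr1 (divn^~ J) E; have := congr1 (modn^~ J) E.
have J0 : (0 < J)%N by apply: leq_trans (ltn_ord j).
rewrite /bit_key /= !modnMDl !modn_small // !divnMDl // !divn_small // !addn0.
move=> jj /val_inj ->; congr pair; apply: val_inj => /=.
by have := ltn_ord j; have := ltn_ord j'; lia.
Qed.

Lemma bit_key_lt (ij ij' : 'I_d * 'I_J) : (bit_key ij' < bit_key ij)%N ->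
  (ij'.1 < ij.1)%N \/ ij'.1 = ij.1 /\ (ij.2 < ij'.2)%N.
Proof.
case: ij ij' => [i j] [i' j']; rewrite /bit_key /= => kk.
have [lt|lt|/val_inj E] := ltngtP i' i; [by left| |right].
  have := leq_mul lt (leqnn J); rewrite mulSn => h; exfalso.
  by have := ltn_ord j; move: kk h; clear; case: j => j /= _; lia.
split=> //; move: kk; rewrite E ltn_add2l; have := ltn_ord j; have := ltn_ord j'.
by clear; lia.
Qed.

(** By [flip_lt] a comparison can change only for two queries that first differ in coordinate [i],
    with highest differing bit [j]; such queries capture [(i, j)]. *)
Lemma bit_indistinguishable q (s : q.-tuple (grid n d)) i (j : 'I_J) :
  ~~ bit_captured s (i, j) tt -> same_order_on s f0 (f1 i j).
Proof.
move=> nc u v; set x := tnth s u; set y := tnth s v.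
have jn : (2 ^ j <= n)%N.
  by apply: leq_trans Jn; rewrite leq_exp2l //; have := ltn_ord j; lia.
have n1 : (1 < 2 * n)%N by have : (0 < 2 ^ j)%N; [rewrite expn_gt0 | lia].
apply: lexval_le => //.
- by move=> k z; have := ltn_ord (z k); rewrite /base_digits; lia.
- move=> k z; rewrite /flipped_digits /flip; have := ltn_ord (z k).
  by case: eqP => _; [case: ifP => _|]; lia.
- move=> k; rewrite /base_digits /flipped_digits /= => h.
  case: eqVneq => // ki; rewrite ki in h *.
  suff nb : ~~ ((x i %/ 2 ^ j.+1 == y i %/ 2 ^ j.+1) && (x i %/ 2 ^ j != y i %/ 2 ^ j))%N.
    by rewrite !flip_lt // [(_ == x i %/ _)%N]eq_sym [(_ == x i %/ 2 ^ j)%N]eq_sym.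
  apply: contra nc => /andP[/eqP e /eqP ne]; apply/capturedP; split=> //.
  exists x, y; split; rewrite ?mem_tnth // => -[i' j'] /= kk _.
  rewrite /bit_val /=; case: (bit_key_lt kk) => /= [lt|[-> jj]]; first by rewrite h.
  have divE w : (w %/ 2 ^ j' = w %/ 2 ^ j.+1 %/ 2 ^ (j' - j.+1))%N.
    by rewrite -divnMA -expnD subnKC.
  by rewrite !divE e.
Qed.

(** For each pair [(i, j)] the acceptance gap of at least 1/3 comes from tuples that capture the
    pair, and a tuple captures at most [q] pairs. *)
Lemma bit_lower_bound q (A : nonadaptive_algorithm R n d q) :
  nonadaptive_unateness_tester A (1 / 8) -> (d * J)%:R / 3 <= q%:R :> R.
Proof.
move=> /order_invariant_of_tester[mu [Q [mu1 Qmu Qinv Qacc Qrej]]].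
have mu0 s : 0 <= mu s by have /andP[a b] := Qmu s f0; exact: le_trans a b.
have cap_prob i (j : 'I_J) : 1 / 3 <= \sum_s mu s * (bit_captured s (i, j) tt)%:R.
  have n0 : (0 < 2 * n)%N by rewrite muln_gt0 (leq_trans _ Jn) // expn_gt0.
  have a := Qacc f0 (@lexval_unate R n d _ _ n0 (fun _ _ _ => id)).
  have r : \sum_s Q s (f1 i j) <= 1 / 3.
    apply: Qrej => f; apply: flipped_far; apply: leq_trans Jn.
    by rewrite leq_exp2l // ltnS.
  have le : \sum_s Q s f0 - \sum_s Q s (f1 i j) <= \sum_s mu s * (bit_captured s (i, j) tt)%:R.
    rewrite -sumrB; apply: ler_sum => s _; case: (boolP (bit_captured s _ _)) => c.
      have := Qmu s f0; have := Qmu s (f1 i j); rewrite mulr1; lra.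
    by rewrite (Qinv s _ _ (bit_indistinguishable c)) subrr mulr0.
  by lra.
have : \sum_(ij : 'I_d * 'I_J) 1 / 3 <= q%:R :> R; last first.
  by rewrite -mulr_suml sumr_const card_prod !card_ord.
apply: (@le_trans _ _ (\sum_(ij : 'I_d * 'I_J) \sum_s mu s * (bit_captured s ij tt)%:R)).
  by rewrite -mulr_suml mulr_suml; apply: ler_sum => -[i j] _; exact: cap_prob.
rewrite exchange_big /=.
apply: (@le_trans _ _ (\sum_s mu s * q%:R)); last by rewrite -mulr_suml mu1 mul1r.
apply: ler_sum => s _.
rewrite -mulr_sumr ler_wpM2l // -natr_sum ler_nat.
have := card_captured bit_val (fun=> tt) bit_key_inj s pred0; rewrite size_tuple; apply: leq_trans.
rewrite -sum_card_pairs; apply: leq_sum => ij _.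
by rewrite (big_pred1 tt) // => -[].
Qed.

End BitLowerBound.

Section LogLemmas.
Variable R : realType.

Lemma ln_le_trunc_log (n : nat) : (0 < n)%N -> ln n%:R <= (trunc_log 2 n).+1%:R :> R.
Proof.
move=> n0; have h : n%:R <= 2 ^+ (trunc_log 2 n).+1 :> R.
  by rewrite -natrX ler_nat ltnW // trunc_log_ltn.
apply: le_trans (_ : ln (2 ^+ (trunc_log 2 n).+1) <= _).
  by rewrite ler_ln ?posrE ?ltr0n // exprn_gt0.
rewrite lnXn // -[X in _ <= X]mulr1 mulr_natl lerMn2r /=.
by apply: (@le_ln1Dx R 1); lra.
Qed.

Lemma log_n_lower_bound n d q (A : nonadaptive_algorithm R n d q) : (8 <= n)%N ->
  nonadaptive_unateness_tester A (1 / 8) -> d%:R * ln n%:R <= 6 * q%:R :> R.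
Proof.
move=> n8 /bit_lower_bound H; have n0 : (0 < n)%N by exact: leq_trans n8.
set t := trunc_log 2 n; have t3 : (3 <= t)%N by rewrite -[3%N](@trunc_expnK 2) // leq_trunc_log.
have := H t.-1; have -> : t.-1.+1 = t by lia.
rewrite trunc_logP // => /(_ isT) {}H.
have : d%:R * ln n%:R <= d%:R * (2 * t.-1)%:R :> R.
  rewrite ler_wpM2l //; apply: le_trans (ln_le_trunc_log n0) _.
  by rewrite ler_nat -/t; lia.
by move: H; rewrite !natrM; lra.
Qed.

End LogLemmas.

(** * Counting the random choices that reveal a hidden coordinate *)

Section Resampling.
Variables (G : finType) (w : nat).
Local Open Scope nat_scope.
Implicit Types (sg : {ffun G -> 'I_w}) (g : G) (o : 'I_w).

Definition upd sg g o : {ffun G -> 'I_w} := [ffun g' => if g' == g then o else sg g'].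

(** Exchanging the old and the new value at [g] is an involution on pairs [(sg, o)]. *)
Lemma sum_resample g (F : {ffun G -> 'I_w} -> nat) :
  \sum_sg \sum_o F (upd sg g o) = w * \sum_sg F sg.
Proof.
rewrite pair_bigA /=.
pose h (x : {ffun G -> 'I_w} * 'I_w) := (upd x.1 g x.2, x.1 g).
have hK : involutive h.
  move=> [sg o]; rewrite /h /=; congr pair; last by rewrite ffunE eqxx.
  by apply/ffunP => g'; rewrite !ffunE; case: eqP => [->|].
rewrite (reindex h) /=; last by exists h => x _; exact: hK.
rewrite (eq_bigr (fun x => F x.1)) => [|x _]; last first.
  by have := congr1 fst (hK x) => /= ->.
rewrite -(pair_bigA _ (fun sg (o : 'I_w) => F sg)) /= big_distrr /=.
by apply: eq_bigr => sg _; rewrite sum_nat_const card_ord.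
Qed.

Lemma sum_marginal g (F : 'I_w -> nat) :
  w * \sum_(sg : {ffun G -> 'I_w}) F (sg g) = w ^ #|G| * \sum_o F o.
Proof.
rewrite -(sum_resample g (fun sg => F (sg g))).
rewrite (eq_bigr (fun=> \sum_o F o)) => [|sg _]; last first.
  by apply: eq_bigr => o _; rewrite ffunE eqxx.
by rewrite sum_nat_const card_ffun card_ord.
Qed.

End Resampling.

(** * Probability that a group is revealed in classes of both parities *)

Section DoubleCapture.
Variables (X P Z : finType) (key : P -> nat) (v : X -> P -> nat) (cls : X -> Z).
Hypothesis key_inj : injective key.
Variables (M w : nat).
Local Notation G := 'I_M.+1.
Local Notation m := M.+1.
Variables (pos : G -> 'I_w -> P) (par : Z -> bool) (adr : Z -> G) (s : seq X).
Hypothesis pos_inj : forall g o g' o', pos g o = pos g' o' -> g = g' /\ o = o'.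
Implicit Types (sg : {ffun G -> 'I_w}) (g r : G) (i : P).

Definition others sg g : pred P := fun p => [exists g', (g' != g) && (p == pos g' (sg g'))].

(** Class [z] belongs to group [adr z + r], with a separate shift [r] for each parity. The hidden
    positions of the other groups will be invisible in [z], and are therefore ignored. *)
Definition revealed sg r b g : bool :=
  [exists z, [&& par z == b, adr z + r == g
             & captured key v cls s (others sg g) (pos g (sg g)) z]].

Definition bad sg r0 r1 : bool :=
  [exists g, revealed sg r0 false g && revealed sg r1 true g].

Local Open Scope nat_scope.

Definition tau i : nat := \sum_z captured key v cls s pred0 i z.

Local Notation cap := (captured key v cls s).
Let mcount b T i := \sum_(a : G) [exists z, [&& par z == b, adr z == a & cap T i z]].
Let excess T i := \sum_z (cap T i z && ~~ cap pred0 i z).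

Let mcount_le_m b T i : mcount b T i <= m.
Proof.
rewrite -[X in _ <= X](card_ord m) -sum1_card; apply: leq_sum => a _.
by case: [exists _, _].
Qed.

Let mcount_le_tau b i : mcount b pred0 i <= minn m (tau i).
Proof.
rewrite leq_min mcount_le_m /=.
apply: (@leq_trans (\sum_a \sum_z ((adr z == a) && cap pred0 i z))).
  apply: leq_sum => a _; case: existsP => [[z /and3P[_ za c]]|//].
  by rewrite (bigD1 z) //= za c.
rewrite exchange_big /=; apply: leq_sum => z _.
rewrite (bigD1 (adr z)) //= eqxx big1 ?addn0 // => a /negPf.
by rewrite eq_sym => ->.
Qed.

Let mcount_le b T i : mcount b T i <=
  mcount b pred0 i + \sum_z ((par z == b) && (cap T i z && ~~ cap pred0 i z)).
Proof.
apply: (@leq_trans (mcount b pred0 i +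
    \sum_a \sum_z ((adr z == a) && ((par z == b) && (cap T i z && ~~ cap pred0 i z))))).
  rewrite -big_split /=; apply: leq_sum => a _.
  case: existsP => [[z /and3P[zb za c]]|//].
  case: (boolP (cap pred0 i z)) => c0.
    by case: existsP => //= -[]; exists z; rewrite zb za.
  by rewrite (bigD1 z) //= zb za c c0 /= addnCA.
rewrite leq_add2l exchange_big /=; apply: leq_sum => z _.
rewrite (bigD1 (adr z)) //= eqxx big1 ?addn0 // => a /negPf.
by rewrite eq_sym => ->.
Qed.

(** Bound each factor by its [pred0] part plus its share of the excess. The [pred0] parts multiply
    to at most the square, and an excess share meets a factor of at most [m]. *)
Let mcount_mul T i :
  mcount false T i * mcount true T i <= minn m (tau i) ^ 2 + m * excess T i.
Proof.
have E : excess T i = \sum_z ((par z == false) && (cap T i z && ~~ cap pred0 i z))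
    + \sum_z ((par z == true) && (cap T i z && ~~ cap pred0 i z)).
  by rewrite -big_split /=; apply: eq_bigr => z _; case: (par z); rewrite ?addn0.
move: (mcount_le false T i) (mcount_le true T i) E.
move: (mcount_le_tau false i) (mcount_le_tau true i) (mcount_le_m true T i).
set e0 := \sum_z _; set e1 := \sum_z _; set t := minn _ _.
move: (geq_minl m (tau i)) => tm; rewrite -/t in tm.
move: (mcount false pred0 i) (mcount true pred0 i) (mcount false T i) (mcount true T i) => *.
subst; nia.
Qed.

Let sum_revealed sg b g :
  \sum_r revealed sg r b g = mcount b (others sg g) (pos g (sg g)).
Proof.
rewrite /mcount (reindex (fun a : G => (g - a)%R)) /=; last first.
  by exists (fun a : G => (g - a)%R) => a _; rewrite opprB addrC subrK.
apply: eq_bigr => a _; congr nat_of_bool; apply: eq_existsb => z.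
by rewrite addrA subr_eq addrC (inj_eq (addrI _)).
Qed.

(** [others sg g] does not depend on [sg g], so a single use of [card_captured_excess] covers all
    candidates [o] for the hidden position of [g]. *)
Let excess_others sg g : \sum_o excess (others sg g) (pos g o) <=
  \sum_(x <- s) \sum_g' minority key v cls s x (pos g' (sg g')).
Proof.
apply: (@leq_trans (\sum_i excess (others sg g) i)).
  have pI : injective (pos g) by move=> o o' /pos_inj[].
  rewrite -[X in X <= _](@big_imset _ _ _ _ _ (pos g) predT (excess (others sg g))) /=; last first.
    by move=> o o' _ _; exact: pI.
  by rewrite [X in _ <= X](bigID (mem [set pos g o | o in predT])) /= leq_addr.
rewrite /excess sum_card_pairs.
apply: leq_trans (card_captured_excess v cls key_inj s (others sg g)) _.
rewrite -sum1_count big_mkcond; apply: leq_sum => x _.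
case: existsP => // -[p /andP[/existsP[g' /andP[_ /eqP ->]] mp]].
by rewrite (bigD1 g') //= mp.
Qed.

(** Divided by [w ^ m * m ^ 2 * w ^ 2], this bounds the probability of [bad] for uniform [sg], [r0],
    [r1]. *)
Lemma card_bad lam : (forall x, x \in s -> #|[set p | minority key v cls s x p]| <= lam) ->
  w ^ 2 * \sum_(sg : {ffun G -> 'I_w}) \sum_(r0 : G) \sum_(r1 : G) bad sg r0 r1 <=
  w ^ m * (w * (\sum_i minn m (tau i) ^ 2) + m ^ 2 * (size s * lam)).
Proof.
move=> lamP.
pose S1 := \sum_g \sum_(sg : {ffun G -> 'I_w}) minn m (tau (pos g (sg g))) ^ 2.
pose S2 := \sum_g \sum_(sg : {ffun G -> 'I_w}) excess (others sg g) (pos g (sg g)).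
(* Union bound over the groups; for a fixed group the sums over [r0] and [r1] factor into the
   product in [mcount_mul]. *)
have le1 : \sum_(sg : {ffun G -> 'I_w}) \sum_(r0 : G) \sum_(r1 : G) bad sg r0 r1 <= S1 + m * S2.
  apply: (@leq_trans (\sum_(sg : {ffun G -> 'I_w}) \sum_g
      (minn m (tau (pos g (sg g))) ^ 2 + m * excess (others sg g) (pos g (sg g))))).
    apply: leq_sum => sg _.
    apply: (@leq_trans (\sum_(r0 : G) \sum_(r1 : G) \sum_g
        revealed sg r0 false g * revealed sg r1 true g)).
      apply: leq_sum => r0 _; apply: leq_sum => r1 _; rewrite /bad.
      case: existsP => // -[g /andP[h0 h1]].
      by rewrite (bigD1 g) //= h0 h1.
    rewrite (eq_bigr (fun r0 => \sum_g \sum_r1 revealed sg r0 false g * revealed sg r1 true g));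
      last by move=> r0 _; rewrite exchange_big.
    rewrite exchange_big /=; apply: leq_sum => g _.
    rewrite (eq_bigr (fun r0 => revealed sg r0 false g * \sum_r1 revealed sg r1 true g));
      last by move=> r0 _; rewrite big_distrr.
    by rewrite -big_distrl /= !sum_revealed mcount_mul.
  rewrite exchange_big /= /S1 /S2 big_distrr -big_split /=; apply: leq_sum => g _.
  by rewrite big_distrr -big_split.
have le2 : w * S1 <= w ^ m * \sum_i minn m (tau i) ^ 2.
  rewrite /S1 big_distrr /=.
  rewrite (eq_bigr (fun g => w ^ m * \sum_o minn m (tau (pos g o)) ^ 2)) => [|g _]; last first.
    by rewrite (sum_marginal g (fun o => minn m (tau (pos g o)) ^ 2)) card_ord.
  rewrite -big_distrr leq_mul2l /=; apply/orP; right; rewrite pair_bigA /=.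
  have pI : injective (fun go : G * 'I_w => pos go.1 go.2).
    by move=> [g o] [g' o'] /= /pos_inj[-> ->].
  rewrite -[X in X <= _](@big_imset _ _ _ _ _ (fun go : G * 'I_w => pos go.1 go.2) predT
    (fun i => minn m (tau i) ^ 2)) /=; last by move=> a b _ _; exact: pI.
  rewrite [X in _ <= X](bigID (mem [set pos go.1 go.2 | go in (predT : pred (G * 'I_w))])) /=.
  exact: leq_addr.
have le3 : w ^ 2 * S2 <= m * (w ^ m * (size s * lam)).
  rewrite /S2 big_distrr /=.
  have -> : m * (w ^ m * (size s * lam)) = \sum_(g : G) w ^ m * (size s * lam).
    by rewrite sum_nat_const card_ord.
  apply: leq_sum => g _; rewrite expnS expn1 -mulnA.
  have -> : w * \sum_(sg : {ffun G -> 'I_w}) excess (others sg g) (pos g (sg g)) =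
      \sum_(sg : {ffun G -> 'I_w}) \sum_o excess (others sg g) (pos g o).
    rewrite -(sum_resample g); apply: eq_bigr => sg _; apply: eq_bigr => o _.
    rewrite ffunE eqxx; apply: eq_bigr => z _; congr (nat_of_bool (_ && _)).
    rewrite /captured; congr (~~ _ && _).
      apply: eq_existsb => g'; case: eqVneq => //= /negPf gg'.
      by rewrite ffunE gg'.
    apply: eq_existsb => x; apply: eq_existsb => y; do 5 congr (_ && _).
    apply: eq_forallb => p; congr (_ ==> (~~ _ ==> _)); apply: eq_existsb => g'.
    by case: eqVneq => //= /negPf gg'; rewrite ffunE gg'.
  apply: (@leq_trans (w * \sum_(sg : {ffun G -> 'I_w}) \sum_(x <- s) \sum_g'
      minority key v cls s x (pos g' (sg g')))).
    by rewrite leq_mul2l; apply/orP; right; apply: leq_sum => sg _; exact: excess_others.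
  rewrite exchange_big big_distrr /=.
  apply: (@leq_trans (\sum_(x <- s) w ^ m * lam)); last first.
    by rewrite big_const_seq count_predT iter_addn_0 -mulnA [lam * _]mulnC.
  rewrite !big_seq; apply: leq_sum => x xs; rewrite exchange_big big_distrr /=.
  rewrite (eq_bigr (fun g' => w ^ m * \sum_o minority key v cls s x (pos g' o))); last first.
    move=> g' _; rewrite -[in RHS](card_ord m).
    exact: (sum_marginal g' (fun o => nat_of_bool (minority key v cls s x (pos g' o)))).
  rewrite -big_distrr leq_mul2l /=; apply/orP; right; apply: leq_trans (lamP _ xs).
  rewrite pair_bigA /=.
  have pI : injective (fun go : G * 'I_w => pos go.1 go.2).
    by move=> [a o] [a' o'] /= /pos_inj[-> ->].
  rewrite -sum1_card [X in _ <= X]big_mkcond /=.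
  rewrite -[X in X <= _](@big_imset _ _ _ _ _ (fun go : G * 'I_w => pos go.1 go.2) predT
    (fun i => nat_of_bool (minority key v cls s x i))) /=; last by move=> a b _ _; exact: pI.
  rewrite [X in _ <= X](bigID (mem [set pos go.1 go.2 | go in (predT : pred (G * 'I_w))])) /=.
  apply: leq_trans (leq_addr _ _); apply: leq_sum => i _; rewrite inE.
  by case: minority.
set B := (X in _ * X <= _) in le1 *; move: (w ^ m) le2 le3 => W le2 le3.
have : w ^ 2 * B <= w * (w * S1) + m * (w ^ 2 * S2).
  have -> : w * (w * S1) + m * (w ^ 2 * S2) = w ^ 2 * (S1 + m * S2) by ring.
  by rewrite leq_mul2l le1 orbT.
move/leq_trans; apply; apply: leq_trans (leq_add (leq_mul (leqnn w) le2) (leq_mul (leqnn m) le3)) _.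
by apply/eq_leq; ring.
Qed.

End DoubleCapture.

(** * The functions with hidden coordinates *)

Section PrefixRank.
Variables (n d : nat).
Implicit Types x y : grid n d.
Local Open Scope nat_scope.

(** The first [k] coordinates as base-[n] digits, least significant first. *)
Definition prefix_rank (k : nat) x : nat := \sum_(p < d | p < k) x p * n ^ p.

Lemma prefix_rankS k x (kd : k < d) :
  prefix_rank k.+1 x = x (Ordinal kd) * n ^ k + prefix_rank k x.
Proof.
rewrite /prefix_rank (bigD1 (Ordinal kd)) //=; congr (_ + _); apply: eq_bigl => p.
by rewrite ltnS [RHS]ltn_neqAle andbC -val_eqE.
Qed.

Lemma prefix_rank_lt k x : k <= d -> prefix_rank k x < n ^ k.
Proof.
elim: k => [|k IH] kd; first by rewrite /prefix_rank big_pred0.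
rewrite (prefix_rankS _ kd) expnS; have := IH (ltnW kd); have := ltn_ord (x (Ordinal kd)).
by set a := nat_of_ord _; move: (prefix_rank k x) (n ^ k) => r N; nia.
Qed.

Lemma prefix_rank_digits k x z : k <= d ->
  (forall p : 'I_d, p < k -> x p = (z %/ n ^ p) %% n :> nat) -> prefix_rank k x = z %% n ^ k.
Proof.
elim: k => [|k IH] kd xz; first by rewrite /prefix_rank big_pred0 // modn1.
have n0 : 0 < n by apply: leq_ltn_trans (ltn_ord (x (Ordinal kd))).
rewrite (prefix_rankS _ kd) IH ?(ltnW kd) // => [|p pk]; last by apply: xz; exact: ltnW.
rewrite xz //= expnSr; set N := n ^ k; have N0 : 0 < N by rewrite expn_gt0 n0.
have E : z = z %/ N %/ n * (N * n) + (z %/ N %% n * N + z %% N).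
  by rewrite {1}(divn_eq z N) {1}(divn_eq (z %/ N) n); ring.
rewrite [in RHS]E modnMDl; symmetry; apply: modn_small.
by have := ltn_pmod z N0; have := ltn_pmod (z %/ N) n0; nia.
Qed.

Lemma prefix_rank_off k (i : 'I_d) x y : k <= i -> agree_off i x y ->
  prefix_rank k x = prefix_rank k y.
Proof.
move=> ki xy; apply: eq_bigr => p pk; rewrite xy //.
by apply: contraTneq pk => ->; rewrite -leqNgt.
Qed.

Lemma prefix_rank_homo k (i : 'I_d) x y : 0 < n -> i < k -> agree_off i x y -> x i < y i ->
  prefix_rank k x < prefix_rank k y.
Proof.
move=> n0 ik xy lt; rewrite /prefix_rank (bigD1 i) //= [X in _ < X](bigD1 i) //=.
rewrite (eq_bigr (fun p => y p * n ^ p)) => [|p /andP[_ pi]]; last by rewrite xy.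
by rewrite ltn_add2r ltn_pmul2r // expn_gt0 n0.
Qed.

End PrefixRank.

Section HardFunctions.
Variables (R : realType) (n d K M w : nat).
Local Notation m := M.+1.
Local Notation G := 'I_M.+1.
Hypotheses (n2 : (2 <= n)%N) (fit : (K + m * w <= d)%N) (Km : (8 * m <= n ^ K)%N).
Implicit Types (x y : grid n d) (g r : G) (p : 'I_d).
Implicit Types (sg : {ffun G -> 'I_w}) (be : {ffun G -> bool}).

Let Kd : (K <= d)%N. Proof. by apply: leq_trans fit; exact: leq_addr. Qed.

Local Notation Z := 'I_(n ^ K).+1.
Local Notation prank := (prefix_rank K).

(** [Z] has a spare element because [inord] needs a successor. Together [par] and [adr] record the
    class modulo [2 * m]. *)
Definition cls x : Z := inord (prank x).
Definition par (z : Z) : bool := odd z.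
Definition adr (z : Z) : G := inZp z./2.
Definition high_bit x p : nat := (K <= p)%N && (n./2 <= x p)%N.

Lemma cls_val x : cls x = prank x :> nat.
Proof. by rewrite inordK // ltnS ltnW // prefix_rank_lt. Qed.

Fact pos_subproof g (o : 'I_w) : (K + g * w + o < d)%N.
Proof.
apply: leq_trans fit; rewrite -addnA ltn_add2l.
have := ltn_ord o; have := leq_mul (ltn_ord g) (leqnn w); rewrite [(g.+1 * w)%N]mulSn; lia.
Qed.

Definition pos g (o : 'I_w) : 'I_d := Ordinal (pos_subproof g o).

Lemma pos_inj g o g' o' : pos g o = pos g' o' -> g = g' /\ o = o'.
Proof.
move=> /(congr1 val) /= E; have w0 : (0 < w)%N by apply: leq_ltn_trans (ltn_ord o).
have {}E : (g * w + o = g' * w + o')%N by apply: (@addnI K); rewrite !addnA.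
have := congr1 (divn^~ w) E; have := congr1 (modn^~ w) E.
rewrite !modnMDl !modn_small // !divnMDl // !divn_small // !addn0.
by move=> /val_inj -> /val_inj ->.
Qed.

Lemma pos_ge g o : (K <= pos g o)%N.
Proof. by rewrite /= -addnA leq_addr. Qed.

Definition group r0 r1 (z : Z) : G := adr z + (if par z then r1 else r0).
Definition hidden sg p : bool := [exists g, p == pos g (sg g)].

(* The hidden coordinate of a group is visible only in the two classes of its
   group; in the far function ([no]) these two classes disagree on its sign. *)
Definition coef (no : bool) r0 r1 sg be (z : Z) p : R :=
  let g := group r0 r1 z in
  if p == pos g (sg g) then (-1) ^+ (be g (+) (no && par z)) else (~~ hidden sg p)%:R.

(** By [hard_tail_le] two tails differ by less than [2 ^+ d.+2], so the prefix rank dominates. *)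
Definition hard no r0 r1 sg be x : R :=
  (prank x)%:R * 2 ^+ d.+2
  + \sum_p coef no r0 r1 sg be (cls x) p * (high_bit x p)%:R * 2 ^+ (d - p).

Lemma coef_cases no r0 r1 sg be z p :
  coef no r0 r1 sg be z p = 0 \/ `|coef no r0 r1 sg be z p| = 1.
Proof.
rewrite /coef; case: eqP => _; first by right; rewrite normr_sign.
by case: (hidden sg p); [left | right; rewrite normr1].
Qed.

Lemma hard_tail_le no r0 r1 sg be z x :
  `|\sum_p coef no r0 r1 sg be z p * (high_bit x p)%:R * 2 ^+ (d - p)| <= 2 ^+ d.+1 - 2.
Proof.
apply: lex_sum_bound => [|p]; first by rewrite ler1n.
rewrite normrM /high_bit; case: (_ && _) => /=; rewrite ?normr0 ?normr1 ?mulr0 ?mulr1; last by lra.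
by case: (coef_cases no r0 r1 sg be z p) => ->; rewrite ?normr0; lra.
Qed.

Lemma hard_lt no r0 r1 sg be x y : (prank x < prank y)%N ->
  hard no r0 r1 sg be x < hard no r0 r1 sg be y.
Proof.
move=> lt; rewrite /hard.
have /ler_normlP[_ hx] := hard_tail_le no r0 r1 sg be (cls x) x.
have /ler_normlP[hy _] := hard_tail_le no r0 r1 sg be (cls y) y.
have : (prank x).+1%:R * 2 ^+ d.+2 <= (prank y)%:R * 2 ^+ d.+2 :> R.
  by rewrite ler_wpM2r ?exprn_ge0 // ler_nat.
rewrite -natr1 mulrDl mul1r [X in _ + X <= _]exprS.
by move: hx hy; set a := \sum_p _; set b := \sum_p _; lra.
Qed.

Lemma hard_le no r0 r1 sg be x y : prank x = prank y ->
  (hard no r0 r1 sg be x <= hard no r0 r1 sg be y) =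
  (\sum_p coef no r0 r1 sg be (cls x) p * ((high_bit x p)%:R - (high_bit y p)%:R)
     * 2 ^+ (d - p) <= 0).
Proof.
move=> E; rewrite /hard -E /cls -E lerD2l -subr_le0 -sumrB.
by under eq_bigr do rewrite -mulrBl -mulrBr.
Qed.

Lemma hard_off no r0 r1 sg be (i : 'I_d) x y : (K <= i)%N -> agree_off i x y ->
  (hard no r0 r1 sg be x <= hard no r0 r1 sg be y) =
  (coef no r0 r1 sg be (cls x) i * ((high_bit x i)%:R - (high_bit y i)%:R) <= 0).
Proof.
move=> Ki xy; rewrite hard_le; last exact: prefix_rank_off xy.
rewrite (bigD1 i) //= big1 ?addr0 => [|p pi].
  by rewrite pmulr_lle0 // exprn_gt0.
by rewrite /high_bit xy // subrr mulr0 mul0r.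
Qed.

Lemma hidden_others r0 r1 sg z p : hidden sg p -> p != pos (group r0 r1 z) (sg (group r0 r1 z)) ->
  others pos sg (group r0 r1 z) p.
Proof.
move=> /existsP[g /eqP ->] ne; apply/existsP; exists g; rewrite eqxx andbT.
by apply: contraNneq ne => ->.
Qed.

Local Notation caught s sg r b g := (revealed val high_bit cls pos par adr s sg r b g).

(** A group revealed in odd classes gets its sign flipped, which cancels the flip made there by the
    far function. Unless [bad] holds, its even classes are not revealed, so the change goes
    unnoticed. [twist] is an involution on the signs and hence preserves averages over them. *)
Definition twist q (s : q.-tuple (grid n d)) sg r1 be : {ffun G -> bool} :=
  [ffun g => be g (+) caught s sg r1 true g].

Lemma hard_indistinguishable q (s : q.-tuple (grid n d)) sg r0 r1 be :
  ~~ bad val high_bit cls pos par adr s sg r0 r1 ->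
  same_order_on s (hard false r0 r1 sg be) (hard true r0 r1 sg (twist s sg r1 be)).
Proof.
move=> /existsPn nb u v; set x := tnth s u; set y := tnth s v.
case: (ltngtP (prank x) (prank y)) => [lt|lt|E].
- by rewrite !ltW // hard_lt.
- by rewrite !leNgt !hard_lt.
rewrite !hard_le //; set z := cls x; pose g := group r0 r1 z.
have ebound no be' p :
    `|coef no r0 r1 sg be' z p * ((high_bit x p)%:R - (high_bit y p)%:R)| <= 2 - 1.
  rewrite normrM; have h : `|(high_bit x p)%:R - (high_bit y p)%:R : R| <= 2%:R - 1.
    by apply: normr_natB_le; rewrite /high_bit ltnS leq_b1.
  by case: (coef_cases no r0 r1 sg be' z p) => ->; rewrite ?normr0; lra.
have ebound1 no be' p : coef no r0 r1 sg be' z p * ((high_bit x p)%:R - (high_bit y p)%:R) = 0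
    \/ 1 <= `|coef no r0 r1 sg be' z p * ((high_bit x p)%:R - (high_bit y p)%:R)|.
  case: (coef_cases no r0 r1 sg be' z p) => C; first by left; rewrite C mul0r.
  rewrite normrM C mul1r; case: (normr_natB_ge1 R (high_bit x p) (high_bit y p)) => h.
    by left; rewrite h mulr0.
  by right.
apply: lex_sum_sign => //; first by rewrite ltr1n.
move=> p e0; have [->|ne] := eqVneq (high_bit x p) (high_bit y p); first by rewrite subrr !mulr0.
congr (Num.sg (_ * _)); rewrite /coef -/g; case: (eqVneq p _) => [pE|//].
(* The other hidden positions have coefficient 0 in class [z], and all coefficients outside the
   hidden positions are 1; so [e0] says that [x] and [y] agree before [p] off [others]. *)
have rev : captured val high_bit cls s (others pos sg g) p z.
  apply/capturedP; split.
    apply/existsPn => g'; rewrite pE; apply/negP => /andP[g'g /eqP /pos_inj[gE _]].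
    by rewrite gE eqxx in g'g.
  exists x, y; rewrite !mem_tnth; split=> //; first by rewrite /z /cls E.
  - exact/eqP.
  move=> p' p'p no'; have /eqP := e0 _ p'p; rewrite mulf_eq0 => /orP[/eqP|].
    rewrite /coef -/g; case: (eqVneq p' _) => [_|ne'].
      by move/eqP; rewrite signr_eq0.
    case: (boolP (hidden sg p')) => [/hidden_others/(_ ne')|_ /eqP]; last by rewrite oner_eq0.
    by rewrite -/g (negPf no').
  by rewrite subr_eq0 eqr_nat => /eqP.
have rv : caught s sg (if par z then r1 else r0) (par z) g.
  by apply/existsP; exists z; rewrite eqxx /= -pE rev andbT.
rewrite ffunE /=; move: rv (nb g); case: (par z) => rv; rewrite rv /= ?andbT.
  by rewrite addbF -addbA addbb addbF.
by move=> /negPf ->; rewrite !addbF.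
Qed.

Lemma high_bit_homo x y p : (x p <= y p)%N -> (high_bit x p <= high_bit y p)%N.
Proof.
rewrite /high_bit => xy; case: (leqP K p) => //= _.
by case: (leqP _ (x p)) => // h; rewrite (leq_trans h xy).
Qed.

Lemma hard_unate r0 r1 sg be : unate (hard false r0 r1 sg be).
Proof.
move=> i; case: (ltnP i K) => iK.
  right=> x y xy; rewrite leq_eqVlt => /orP[/eqP e|lt].
    suff -> : x = y by [].
    apply/ffunP => j; case: (eqVneq j i) => [->|/xy //]; exact: val_inj.
  by apply/ltW/hard_lt; apply: prefix_rank_homo lt => //; exact: leq_trans n2.
have mono x y : (x i <= y i)%N -> (high_bit x i)%:R - (high_bit y i)%:R <= 0 :> R.
  by move=> /high_bit_homo h; rewrite subr_le0 ler_nat.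
have yx x y : agree_off i x y -> agree_off i y x by move=> xy j /xy.
case: (boolP (hidden sg i)) => [/existsP[g /eqP iE]|nh]; last first.
  right=> x y xy /mono le; rewrite (hard_off _ _ _ _ _ iK xy).
  rewrite /coef nh; case: eqP => [ie|_]; last by rewrite mul1r.
  by case/negP: nh; apply/existsP; eexists; apply/eqP; exact: ie.
have coefE z : coef false r0 r1 sg be z i = 0 \/ coef false r0 r1 sg be z i = (-1) ^+ be g.
  rewrite /coef; case: eqP => [E|_]; last first.
    by left; have -> : hidden sg i by apply/existsP; exists g; apply/eqP.
  by right; have [<- _] := pos_inj (etrans (esym iE) E); rewrite addbF.
case: (be g) coefE => coefE; [left|right] => x y xy /mono le.
  rewrite (hard_off _ _ _ _ _ iK (yx _ _ xy)).
  by case: (coefE (cls y)) => ->; [rewrite mul0r | rewrite expr1 mulN1r; lra].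
rewrite (hard_off _ _ _ _ _ iK xy).
by case: (coefE (cls x)) => ->; [rewrite mul0r | rewrite expr0 mul1r].
Qed.

Let n0 : (0 < n)%N. Proof. exact: leq_trans n2. Qed.

Lemma card_class (z : Z) (A : pred 'I_n) (i : 'I_d) : (K <= i)%N -> (z < n ^ K)%N ->
  (#|A| * n ^ (d - K) <= n * #|[set x : grid n d | (cls x == z) && A (x i)]%SET|)%N.
Proof.
move=> Ki zK; pose y : grid n d := [ffun p : 'I_d => Ordinal (ltn_pmod (z %/ n ^ p) n0)].
rewrite -(card_cylinder y A Ki) leq_mul2l; apply/orP; right; apply: subset_leq_card.
apply/fintype.subsetP => x; rewrite !inE => /andP[-> /forallP xy]; rewrite andbT.
apply/eqP/val_inj => /=; rewrite cls_val (prefix_rank_digits (z := z)) ?modn_small // => p pK.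
by have := xy p; rewrite pK => /eqP ->; rewrite ffunE.
Qed.

(** In each complete block of [2 * m] consecutive ranks every group owns one class of each parity;
    [f] picks the one of parity [b g]. *)
Lemma card_classes r0 r1 (b : G -> bool) :
  (m * (n ^ K %/ (2 * m)) <=
     #|[set z : Z | (z < n ^ K)%N && (par z == b (group r0 r1 z))]%SET|)%N.
Proof.
set u := (n ^ K %/ _)%N.
pose c g : G := g - (if b g then r1 else r0).
have lt_u (a : 'I_u) g : (2 * m * a + 2 * c g + b g < n ^ K)%N.
  have h : (u * (2 * m) <= n ^ K)%N by exact: leq_trunc_div.
  have := leq_mul (ltn_ord a) (leqnn (2 * m)); rewrite [(a.+1 * _)%N]mulSn.
  have := ltn_ord (c g); have : (b g <= 1)%N := leq_b1 _.
  by rewrite [(2 * m * a)%N]mulnC; lia.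
pose f (ga : G * 'I_u) : Z := inord (2 * m * ga.2 + 2 * c ga.1 + b ga.1).
have fE ga : f ga = (2 * m * ga.2 + 2 * c ga.1 + b ga.1)%N :> nat.
  by rewrite inordK // ltnS ltnW.
have par_f ga : par (f ga) = b ga.1.
  by rewrite /par fE -mulnA -mulnDr oddD oddM /=; case: (b ga.1).
have half_f ga : (f ga)./2 = (m * ga.2 + c ga.1)%N.
  by rewrite fE -mulnA -mulnDr halfD mul2n odd_double /= doubleK; case: (b ga.1); rewrite addn0.
have group_f ga : group r0 r1 (f ga) = ga.1.
  rewrite /group par_f; have -> : adr (f ga) = c ga.1.
    by apply: val_inj; rewrite /= half_f mulnC modnMDl modn_small.
  by rewrite /c subrK.
have fI : injective f.
  move=> ga ga' E; have g1 : ga.1 = ga'.1 by rewrite -(group_f ga) E group_f.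
  have : ga.2 = ga'.2.
    apply: val_inj; have := congr1 (@nat_of_ord _) E; rewrite !fE g1 => /addIn /addIn /eqP.
    by rewrite eqn_pmul2l ?muln_gt0 // => /eqP.
  by case: ga ga' g1 {E} => g a [g' a'] /= -> ->.
have <- : (#|{: G * 'I_u}| = m * u)%N by rewrite card_prod !card_ord.
rewrite -(fintype.card_codom fI); apply: subset_leq_card; apply/fintype.subsetP => z.
by move=> /codomP[ga ->]; rewrite inE group_f par_f eqxx fE lt_u.
Qed.

Lemma hard_far r0 r1 sg be (f : grid n d -> R) :
  same_order f (hard true r0 r1 sg be) -> far_from_unate (1 / 8) f.
Proof.
move=> fo; apply: far_of_pairs => h uh; set t := n./2.
have t2 : (t + t <= n)%N by rewrite addnn -[X in (_ <= X)%N]odd_double_half leq_addl.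
pose gr x := group r0 r1 (cls x); pose ax x := pos (gr x) (sg (gr x)).
(* The parity of the classes in which [f] goes against the direction of [h] at the hidden position
   of [g]. *)
pose b g := be g (+) `[< nondecreasing_in h (pos g (sg g)) >].
pose S := [set x : grid n d | (par (cls x) == b (gr x)) && (x (ax x) < t)%N]%SET.
pose sh x := shift (ax x) t x.
have in_n x : (x (ax x) < t)%N -> (x (ax x) + t < n)%N.
  by move=> xt; apply: leq_trans t2; rewrite ltn_add2r.
have cls_sh x : cls (sh x) = cls x.
  by congr inord; symmetry; apply: prefix_rank_off (pos_ge _ _) (shift_off _ _).
exists S, sh; split.
- move=> x y; rewrite !inE => /andP[_ /in_n xn] /andP[_ /in_n yn] E.
  have cE : cls x = cls y by rewrite -cls_sh E cls_sh.
  have aE : ax x = ax y by rewrite /ax /gr cE.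
  by move: E xn; rewrite /sh aE => E xn; exact: shift_eq E.
- move=> x; rewrite !inE => /andP[_ xt]; rewrite /ax /gr cls_sh -/(gr x) -/(ax x).
  by rewrite (shift_at (in_n _ xt)) ltnNge leq_addl andbF.
- move=> x; rewrite inE => /andP[/eqP px xt].
  case: (eqVneq (f x) (h x)) => [fx|/eqP]; last by left.
  right=> fy; have xy : agree_off (ax x) x (sh x) := @shift_off _ _ _ t x.
  have yx : agree_off (ax x) (sh x) x by move=> j /xy.
  have hbx : high_bit x (ax x) = 0%N by rewrite /high_bit [(t <= _)%N]leqNgt xt andbF.
  have hby : high_bit (sh x) (ax x) = 1%N.
    by rewrite /high_bit (shift_at (in_n _ xt)) leq_addl pos_ge.
  have cE no : coef no r0 r1 sg be (cls x) (ax x) = (-1) ^+ (be (gr x) (+) (no && par (cls x))).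
    by rewrite /coef eqxx.
  have le : (x (ax x) <= sh x (ax x))%N by rewrite (shift_at (in_n _ xt)) leq_addr.
  have fle : (f x <= f (sh x)) = ~~ `[< nondecreasing_in h (ax x) >].
    rewrite fo (hard_off _ _ _ _ _ (pos_ge _ _) xy) cE hbx hby px /b addbA addbb addFb sub0r mulrN1.
    by case: asboolP => _; rewrite /= ?expr0 ?expr1 ?opprK ?lerN10 // ler10.
  have fge : (f (sh x) <= f x) = `[< nondecreasing_in h (ax x) >].
    rewrite fo (hard_off _ _ _ _ _ (pos_ge _ _) yx) cls_sh cE hbx hby px /b.
    rewrite addbA addbb addFb subr0 mulr1.
    by case: asboolP => _; rewrite /= ?expr0 ?expr1 ?lerN10 // ler10.
  case: (asboolP (nondecreasing_in h (ax x))) => nd.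
    by have := nd _ _ xy le; rewrite -fx -fy fle asboolT.
  case: (uh (ax x)) => // ni; have := ni _ _ xy le.
  by rewrite -fx -fy fge asboolF.
have SE : (\sum_(z : Z | (z < n ^ K)%N && (par z == b (group r0 r1 z)))
    n * #|[set x : grid n d |
      (cls x == z) && (x (pos (group r0 r1 z) (sg (group r0 r1 z))) < t)%N]%SET|
    <= n * #|S|)%N.
  rewrite -big_distrr leq_mul2l; apply/orP; right => /=.
  rewrite -[X in (_ <= X)%N]sum1_card (partition_big cls predT) //=.
  rewrite big_mkcond /=; apply: leq_sum => z _; case: ifP => // /andP[_ zb].
  rewrite -sum1_card; apply/eq_leq; apply: eq_bigl => x; rewrite !inE [RHS]andbC.
  by case: eqP => //= xz; rewrite /ax /gr xz zb.
have tE : #|(fun k : 'I_n => (k < t)%N)| = t.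
  rewrite -sum1_card -(big_ord_widen n (fun=> 1%N)) ?sum1_card ?card_ord //.
  exact: leq_trans (leq_addr _ _) t2.
have le : (m * (n ^ K %/ (2 * m)) * (t * n ^ (d - K)) <= n * #|S|)%N.
  apply: leq_trans SE; apply: leq_trans (leq_mul (card_classes r0 r1 b) (leqnn _)) _.
  rewrite -sum1_card big_distrl /=.
  rewrite (eq_bigl (fun z : Z => (z < n ^ K)%N && (par z == b (group r0 r1 z)))); last first.
    by move=> z; rewrite inE.
  apply: leq_sum => z /andP[zK _]; rewrite mul1n -{1}tE.
  exact: (card_class (fun k : 'I_n => (k < t)%N) (pos_ge _ _) zK).
rewrite -(leq_pmul2l n0) mulnCA; apply: leq_trans (leq_mul (leqnn 8) le).
rewrite -[in X in (X <= _)%N](subnKC Kd) expnD.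
rewrite [X in (_ <= X)%N](_ : _ = 8 * (m * (n ^ K %/ (2 * m)) * t) * n ^ (d - K))%N; last by ring.
rewrite mulnA leq_mul2r; apply/orP; right.
(* At least 3/8 of the classes have the chosen parity, as [8 * m <= n ^ K] bounds the incomplete
   block, and at least 1/3 of the digits lie below [t]. The product is 1/8. *)
have n3 : (n <= 3 * t)%N by have := odd_double_half n; rewrite -/t -muln2; case: odd; lia.
have u3 : (3 * n ^ K <= 8 * (m * (n ^ K %/ (2 * m))))%N.
  have := divn_eq (n ^ K) (2 * m); have := @ltn_pmod (n ^ K) (2 * m); rewrite muln_gt0 => /(_ isT).
  move: Km; set N := (n ^ K)%N; set qq := (N %/ _)%N; set rr := (N %% _)%N; clear.
  move=> Km rm NE; have : (qq * (2 * m) = 2 * (m * qq))%N by ring.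
  by move: (m * qq)%N NE => mq -> e; lia.
rewrite mulnA -(leq_pmul2l (isT : 0 < 3)%N) mulnCA mulnC -mulnA.
by have := leq_mul u3 n3; rewrite -mulnA [X in (_ <= X)%N -> _]mulnCA.
Qed.

(** Averaged over the signs, the acceptance gap of a tuple vanishes unless [bad] holds, by [twist].
    So [bad] has probability at least 1/3, and [card_bad] applies with the logarithmic bound of
    [card_minority]. *)
Lemma scale_lower_bound q mu Q :
  @order_invariant_tester R n d q mu Q ->
  (m ^ 2 * w ^ 2)%:R / 3 <= \sum_s mu s *
    (w * (\sum_i minn m (tau val high_bit cls s i) ^ 2) + m ^ 2 * (q * trunc_log 2 q))%:R.
Proof.
move=> [mu1 Qmu Qinv Qacc Qrej].
have mu0 s : 0 <= mu s by have /andP[h h'] := Qmu s (fun=> 0); exact: le_trans h h'.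
have w_gt0 : (0 < w)%N \/ w = 0%N by case: (w); [right|left].
case: w_gt0 => [w0|w0]; last first.
  rewrite w0 exp0n // muln0 mul0r; apply: sumr_ge0 => s _.
  by rewrite mulr_ge0.
pose B (s : q.-tuple (grid n d)) := (\sum_(sg : {ffun G -> 'I_w}) \sum_(r0 : G) \sum_(r1 : G)
   bad val high_bit cls pos par adr (tval s) sg r0 r1)%N.
have step sg r0 r1 : (2 ^ m)%:R / 3 <= \sum_s mu s *
    ((2 ^ m)%:R * (bad val high_bit cls pos par adr (tval s) sg r0 r1)%:R).
  have per_be be : 1 / 3 <= \sum_s (Q s (hard false r0 r1 sg be) - Q s (hard true r0 r1 sg be)).
    have a := Qacc _ (hard_unate r0 r1 sg be).
    have r := Qrej _ (fun f => @hard_far r0 r1 sg be f).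
    by rewrite sumrB; lra.
  apply: (@le_trans _ _ (\sum_be \sum_s
        (Q s (hard false r0 r1 sg be) - Q s (hard true r0 r1 sg be)))).
    apply: (@le_trans _ _ (\sum_(be : {ffun G -> bool}) 1 / 3)).
      by rewrite -mulr_suml sumr_const card_ffun card_bool card_ord.
    by apply: ler_sum => be _; exact: per_be.
  rewrite exchange_big /=; apply: ler_sum => s _.
  case: (boolP (bad _ _ _ _ _ _ _ _ _ _)) => [_|nb]; last first.
    rewrite !mulr0 sumrB subr_le0.
    have twK : involutive (twist s sg r1).
      by move=> be; apply/ffunP => g; rewrite !ffunE -addbA addbb addbF.
    rewrite [X in _ <= X](reindex (twist s sg r1)) /=; last first.
      by exists (twist s sg r1) => be _; exact: twK.
    by apply: ler_sum => be _; rewrite (Qinv _ _ _ (hard_indistinguishable be nb)).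
  apply: (@le_trans _ _ (\sum_(be : {ffun G -> bool}) mu s)).
    apply: ler_sum => be _; have := Qmu s (hard false r0 r1 sg be).
    by have := Qmu s (hard true r0 r1 sg be); lra.
  by rewrite sumr_const card_ffun card_bool card_ord mulr1 mulr_natr.
have sumE (T : finType) (c : R) : \sum_(x : T) c = c * #|T|%:R.
  by rewrite sumr_const mulr_natr.
have sumB : (w ^ m * (m * m))%:R / 3 <= \sum_s mu s * (B s)%:R.
  have p0 : 0 < (2 ^ m)%:R :> R by rewrite ltr0n expn_gt0.
  rewrite -(ler_pM2l p0) mulr_sumr.
  apply: (@le_trans _ _ (\sum_(sg : {ffun G -> 'I_w}) \sum_(r0 : G) \sum_(r1 : G) (2 ^ m)%:R / 3)).
    rewrite !sumE card_ffun !card_ord; move: (w ^ m)%N (2 ^ m)%N => a b.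
    by rewrite !natrM le_eqVlt; apply/orP; left; apply/eqP; ring.
  apply: (@le_trans _ _ (\sum_(sg : {ffun G -> 'I_w}) \sum_(r0 : G) \sum_(r1 : G) \sum_s mu s *
    ((2 ^ m)%:R * (bad val high_bit cls pos par adr (tval s) sg r0 r1)%:R))).
    by do 3 (apply: ler_sum => ? _); exact: step.
  rewrite (eq_bigr (fun sg => \sum_s \sum_r0 \sum_r1 mu s *
    ((2 ^ m)%:R * (bad val high_bit cls pos par adr (tval s) sg r0 r1)%:R))) => [|sg _]; last first.
    rewrite [RHS]exchange_big /=; apply: eq_bigr => r0 _; exact: exchange_big.
  rewrite exchange_big /=; apply: ler_sum => s _; rewrite /B !natr_sum mulrCA !mulr_sumr.
  apply: ler_sum => sg _; rewrite natr_sum !mulr_sumr; apply: ler_sum => r0 _.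
  by rewrite natr_sum !mulr_sumr; apply: ler_sum => r1 _.
have p0 : 0 < (w ^ m)%:R :> R by rewrite ltr0n expn_gt0 w0.
rewrite -(ler_pM2l p0) mulr_sumr.
apply: (@le_trans _ _ (\sum_s mu s * (w ^ 2 * B s)%:R)).
  rewrite (_ : \sum_s _ = (w ^ 2)%:R * \sum_s mu s * (B s)%:R); last first.
    by rewrite mulr_sumr; apply: eq_bigr => s _; rewrite natrM; ring.
  have w20 : 0 <= (w ^ 2)%:R :> R by [].
  apply: le_trans (ler_wpM2l w20 sumB); rewrite mulnn.
  move: (w ^ m)%N (w ^ 2)%N (m ^ 2)%N => a b c.
  by rewrite !natrM le_eqVlt; apply/orP; left; apply/eqP; ring.
apply: ler_sum => s _; rewrite mulrCA ler_wpM2l // -natrM ler_nat.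
have := @card_bad _ _ _ _ high_bit cls val_inj M w pos par adr s pos_inj (trunc_log 2 q).
rewrite size_tuple; apply => x xs; apply: trunc_log_max => //.
have := @card_minority _ _ _ val high_bit cls val_inj s _ x xs.
by rewrite size_tuple; apply=> y p; rewrite ltnS leq_b1.
Qed.

End HardFunctions.

(** * The bound d log d *)

Section Scales.
Variable R : realType.

Lemma sum_min_sq (t kappa : nat) :
  \sum_(k < kappa) (minn (2 ^ k) t ^ 2)%:R / 2 ^+ k <= 4 * t%:R :> R.
Proof.
have t0 : 0 <= t%:R :> R by [].
(* The terms are [2 ^ k] up to scale [t] and then [t ^ 2 / 2 ^ k]. The subtracted amount is the
   remaining geometric tail, which makes the induction go through. *)
suff [[_ le]|[]] : ((t <= 2 ^ kappa)%N /\ \sum_(k < kappa) (minn (2 ^ k) t ^ 2)%:R / 2 ^+ k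
      <= 4 * t%:R - 2 * (t%:R ^+ 2 / 2 ^+ kappa) :> R)
    \/ ((2 ^ kappa < t)%N /\
        \sum_(k < kappa) (minn (2 ^ k) t ^ 2)%:R / 2 ^+ k <= 2 ^+ kappa :> R).
- apply: le_trans le _; rewrite lerBlDr lerDl mulr_ge0 // divr_ge0 ?exprn_ge0 //.
- move=> lt le; apply: le_trans le _; move: lt; rewrite -(ltr_nat R) natrX => lt.
  by move: lt t0; lra.
elim: kappa => [|k IH].
  rewrite big_ord0 !expr0 divr1; case: (t) => [|[|t']]; [left|left|right].
  - by split=> //; rewrite expr0n /= !mulr0 subrr.
  - by split=> //; rewrite (_ : 1%:R = 1) // expr1n; lra.
  - by rewrite ler01.
have u0 : 0 < 2 ^+ k :> R by rewrite exprn_gt0.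
rewrite big_ord_recr /=; case: (leqP t (2 ^ k)) => tk.
  left; split; first by apply: leq_trans tk _; rewrite leq_exp2l.
  case: IH => [[_ IH]|[lt _]]; last by rewrite ltnNge tk in lt.
  rewrite natrX; move: IH; set S := \sum_(_ < _) _.
  have -> : t%:R ^+ 2 / 2 ^+ k.+1 = t%:R ^+ 2 / 2 ^+ k / 2 :> R.
    by rewrite [2 ^+ k.+1]exprSr invfM mulrA.
  by set a := t%:R ^+ 2 / _; lra.
have tk' : 2 ^+ k < t%:R :> R by rewrite -natrX ltr_nat.
have IH' : \sum_(i < k) (minn (2 ^ i) t ^ 2)%:R / 2 ^+ i <= 2 ^+ k :> R.
  by case: IH => [[le _]|[_ //]]; rewrite ltnNge le in tk.
have e : ((2 ^ k) ^ 2)%N%:R / 2 ^+ k = 2 ^+ k :> R.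
  by rewrite !natrX expr2 mulfK // gt_eqF.
rewrite natrX in e; rewrite natrX e [2 ^+ k.+1]exprS.
case: (leqP t (2 ^ k.+1)) => tk1; [left|right]; last by split=> //; lra.
split=> //; have {}tk1 : t%:R <= 2 * 2 ^+ k :> R by rewrite -exprS -natrX ler_nat.
apply: le_trans (lerD IH' (lexx _)) _.
rewrite -subr_ge0 -(pmulr_lge0 _ u0).
have -> : (4 * t%:R - 2 * (t%:R ^+ 2 / (2 * 2 ^+ k)) - (2 ^+ k + 2 ^+ k)) * 2 ^+ k
   = 4 * t%:R * 2 ^+ k - t%:R ^+ 2 - 2 * 2 ^+ k ^+ 2 :> R.
  by field; rewrite gt_eqF.
by move: tk' tk1; set a := t%:R; set u := 2 ^+ k; nra.
Qed.

(** False for [k] from 1 to 3. In its use [8 * k + 7] bounds the logarithm of [q]. *)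
Lemma poly_le_exp4 k : (4 <= k)%N -> ((8 * k + 7) * k <= 4 ^ k)%N.
Proof.
elim: k => // k IH; rewrite leq_eqVlt => /orP[/eqP <- //|k4].
by have := IH k4; rewrite expnS; move: (4 ^ k)%N k4 {IH} => X k4; nia.
Qed.

Lemma log_d_lower_bound n d q (A : nonadaptive_algorithm R n d q) :
  (2 <= n)%N -> (2 ^ 16 <= d)%N ->
  nonadaptive_unateness_tester A (1 / 8) -> d%:R * ln d%:R <= 480 * q%:R :> R.
Proof.
move=> n2 d16 HA; have d0 : (0 < d)%N by apply: leq_trans d16.
have dR : 0 < d%:R :> R by rewrite ltr0n.
(* Scales below [kappa] have [m ^ 2] at most about the square root of [d], which keeps the excess
   term small even after summation over all scales. *)
set e := trunc_log 2 d; pose kappa := (e %/ 4)%N.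
have e16 : (16 <= e)%N by apply: trunc_log_max.
have k4 : (4 <= kappa)%N by rewrite leq_divRL.
have lnd := ln_le_trunc_log R d0; rewrite -/e in lnd.
have ek : (e < 4 * kappa + 4)%N.
  by have := ltn_ceil e (isT : 0 < 4)%N; rewrite -/kappa mulSn mulnC addnC.
have d4k : (2 ^ (4 * kappa) <= d)%N.
  apply: leq_trans (trunc_logP (isT : 1 < 2)%N d0).
  by rewrite leq_exp2l // mulnC leq_trunc_div.
(* For [q >= d ^ 2] the claim follows from [ln d <= d]; otherwise [lam] is at most about twice the
   binary logarithm of [d]. *)
case: (leqP (d ^ 2) q) => dq.
  have : ln d%:R <= d%:R :> R.
    apply: le_trans lnd _; rewrite ler_nat; apply: leq_trans (trunc_logP (isT : 1 < 2)%N d0).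
    exact: ltn_expl.
  have : (d%:R * d%:R <= q%:R :> R) by rewrite -natrM ler_nat mulnn.
  have q0 : 0 <= q%:R :> R by [].
  by move=> h1 h2; have := ler_wpM2l (ltW dR) h2; lra.
have [mu [Q HQ]] := order_invariant_of_tester HA.
have [mu1 Qmu _ _ _] := HQ.
have mu0 s : 0 <= mu s by have /andP[h h'] := Qmu s (fun=> 0); exact: le_trans h h'.
set lam := trunc_log 2 q.
pose K := d./2; pose D := (d - K)%N.
have Kd : (d <= 2 * D)%N.
  by have := odd_double_half d; rewrite /D /K -muln2; case: odd; lia.
have half_d : (2 ^ (4 * kappa).-1 <= K)%N.
  have : (2 ^ (4 * kappa) = (2 ^ (4 * kappa).-1).*2)%N.
    by rewrite -mul2n -expnS prednK // muln_gt0 (leq_trans _ k4).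
  by move=> E; rewrite /K -[X in (X <= _)%N]doubleK -E half_leq.
have small (k : 'I_kappa) : (k + 3 <= K)%N /\ (2 ^ k <= D)%N.
  have kk := ltn_ord k; split.
    apply: leq_trans (ltnW (ltn_expl (k + 3) (isT : 1 < 2)%N)) _.
    by apply: leq_trans half_d; rewrite leq_exp2l //; lia.
  apply: (@leq_trans K); last by rewrite /D /K; have := odd_double_half d; rewrite -muln2; lia.
  by apply: leq_trans half_d; rewrite leq_exp2l //; lia.
pose tau_ (s : q.-tuple (grid n d)) (i : 'I_d) := tau val (@high_bit n d K) (@cls n d K) (tval s) i.
(* [scale_lower_bound] for [m = 2 ^ k] and [w = D %/ m], divided by [m ^ 2 * w ^ 2]. The constants 4
   and 16 come from [d <= 4 * m * w]. *)
have scale (k : 'I_kappa) : 1 / 3 <= \sum_(s : q.-tuple (grid n d)) mu s *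
    (4 / d%:R * (\sum_i (minn (2 ^ k) (tau_ s i) ^ 2)%:R / 2 ^+ k)
     + 16 * (q * lam)%:R * 4 ^+ kappa / d%:R ^+ 2).
  have [kK kD] := small k.
  have m0 : (0 < 2 ^ k)%N by rewrite expn_gt0.
  have m8 : (8 * 2 ^ k <= 2 ^ K)%N by rewrite -(expnD 2 3 k) leq_exp2l // addnC.
  have mE : 2 ^+ k = (2 ^ k)%N%:R :> R by rewrite natrX.
  have m4 : (2 ^ k)%N%:R ^+ 2 <= 4 ^+ kappa :> R.
    rewrite -!natrX ler_nat -expnM mulnC expnM leq_exp2l //; exact: ltnW.
  rewrite mE; move: (2 ^ k)%N kD m0 m8 m4 {mE} => m kD m0 m8 m4.
  pose M := m.-1; have ME : M.+1 = m by rewrite prednK.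
  pose w := (D %/ m)%N; have w0 : (0 < w)%N by rewrite divn_gt0.
  have fit : (K + M.+1 * w <= d)%N.
    have KD : (K + D = d)%N by rewrite subnKC // /K; have := odd_double_half d; rewrite -muln2; lia.
    by rewrite ME -[X in (_ <= X)%N]KD leq_add2l mulnC leq_trunc_div.
  have Km : (8 * M.+1 <= n ^ K)%N.
    have K0 : (0 < K)%N by apply: leq_trans kK; rewrite addn3.
    have nK : (2 ^ K <= n ^ K)%N by rewrite leq_exp2r.
    by rewrite ME; exact: leq_trans nK.
  have := scale_lower_bound n2 fit Km HQ; rewrite ME -/lam.
  have mR : 0 < m%:R :> R by rewrite ltr0n.
  have wR : 0 < w%:R :> R by rewrite ltr0n.
  have dmw : d%:R <= 4 * (m%:R * w%:R) :> R.
    rewrite -!natrM ler_nat; apply: leq_trans Kd _.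
    have : (D < w.+1 * m)%N by exact: ltn_ceil.
    have : (m <= w * m)%N by rewrite leq_pmull.
    by rewrite mulSn [(m * w)%N]mulnC; lia.
  rewrite -[X in X <= _ -> _]mulr1 => H.
  have mw2 : 0 < (m ^ 2 * w ^ 2)%:R :> R by rewrite natrM mulr_gt0 // ltr0n expn_gt0 ?m0 ?w0.
  rewrite -(ler_pM2l mw2); apply: le_trans (_ : _ <= (m ^ 2 * w ^ 2)%:R / 3 * 1) _.
    by rewrite mulr1 mul1r.
  apply: le_trans H _; rewrite mulr_sumr; apply: ler_sum => s _.
  rewrite mulrCA ler_wpM2l // natrD mulrDr.
  rewrite [(w * _)%:R]natrM [(m ^ 2 * (q * lam))%:R]natrM [(m ^ 2 * w ^ 2)%:R]natrM.
  rewrite [(q * lam)%:R]natrM [(m ^ 2)%:R]natrX [(w ^ 2)%:R]natrX; apply: lerD.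
    rewrite -mulr_suml -natr_sum; set S := (\sum_i _)%N.
    have S0 : 0 <= S%:R :> R by [].
    have -> : m%:R ^+ 2 * w%:R ^+ 2 * (4 / d%:R * (S%:R / m%:R)) =
       w%:R * S%:R * (4 * (m%:R * w%:R) / d%:R) :> R by field; rewrite !gt_eqF.
    rewrite ler_peMr ?mulr_ge0 // ler_pdivlMr // mul1r; exact: dmw.
  set L := (q%:R * lam%:R); have L0 : 0 <= L by rewrite mulr_ge0.
  have d2 : d%:R ^+ 2 <= 16 * (m%:R * w%:R) ^+ 2 :> R.
    rewrite (_ : 16 * _ = (4 * (m%:R * w%:R)) ^+ 2); last by ring.
    by rewrite lerXn2r // nnegrE ?ltW // !mulr_gt0.
  have -> : m%:R ^+ 2 * w%:R ^+ 2 * (16 * L * 4 ^+ kappa / d%:R ^+ 2) =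
     L * 4 ^+ kappa * (16 * (m%:R * w%:R) ^+ 2 / d%:R ^+ 2) :> R.
    by field; rewrite gt_eqF.
  apply: (@le_trans _ _ (L * 4 ^+ kappa)).
    by rewrite mulrC ler_wpM2l.
  by rewrite ler_peMr ?mulr_ge0 ?exprn_ge0 // ler_pdivlMr ?exprn_gt0 // mul1r.
have tau_sum s : (\sum_i tau_ s i <= q)%N.
  rewrite /tau_ /tau sum_card_pairs -[X in (_ <= X)%N](size_tuple s).
  exact: card_captured val_inj _ _.
have lamk : (lam * (kappa * 4 ^ kappa) <= d)%N.
  have q_lt : (q < 2 ^ (2 * e + 2))%N.
    apply: leq_trans dq _; rewrite -[(2 * e + 2)%N]/(2 * e + 2 * 1)%N -mulnDr addn1 mulnC expnM.
    by rewrite leq_exp2r // ltnW // trunc_log_ltn.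
  have lam_le : (lam <= 8 * kappa + 7)%N.
    have : (lam < 2 * e + 2)%N.
      case: (posnP q) => [q0|q0]; first by rewrite /lam q0 /= addn2.
      by rewrite -(ltn_exp2l _ _ (isT : 1 < 2)%N); apply: leq_ltn_trans q_lt; exact: trunc_logP.
    by lia.
  apply: leq_trans d4k; rewrite expnM -[(2 ^ 4)%N]/(4 * 4)%N expnMn mulnA leq_mul2r.
  apply/orP; right; apply: leq_trans (poly_le_exp4 k4).
  by rewrite leq_mul2r lam_le orbT.
(* Summing over the scales, the first term is handled by [sum_min_sq] and [tau_sum], the second by
   [lamk]. *)
have total : kappa%:R / 3 <= 16 * q%:R / d%:R + 16 * q%:R / d%:R :> R.
  apply: (@le_trans _ _ (\sum_(k < kappa) 1 / 3)).
    by rewrite sumr_const card_ord -[X in _ <= X]mulr_natr; lra.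
  apply: le_trans (ler_sum _ (fun k _ => scale k)) _; rewrite exchange_big /=.
  set r := _ + _; apply: (@le_trans _ _ (\sum_s mu s * r)); last by rewrite -mulr_suml mu1 mul1r.
  apply: ler_sum => s _; rewrite -mulr_sumr ler_wpM2l // big_split /=; apply: lerD.
    rewrite -mulr_sumr exchange_big /=.
    apply: (@le_trans _ _ (4 / d%:R * \sum_i 4 * (tau_ s i)%:R)).
      rewrite ler_wpM2l ?divr_ge0 //; apply: ler_sum => i _; exact: sum_min_sq.
    rewrite -mulr_sumr -natr_sum.
    have : (\sum_i tau_ s i)%:R <= q%:R :> R by rewrite ler_nat.
    set S := (\sum_i _)%N => Sq; rewrite [X in X <= _](_ : _ = 16 * S%:R / d%:R); last by ring.
    by rewrite ler_pM2r ?invr_gt0 // ler_pM2l.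
  rewrite sumr_const card_ord -[X in X <= _]mulr_natr.
  have -> : 16 * (q * lam)%:R * 4 ^+ kappa / d%:R ^+ 2 * kappa%:R =
      16 * q%:R / d%:R * ((lam * (kappa * 4 ^ kappa))%:R / d%:R) :> R.
    by rewrite !natrM natrX; field; rewrite gt_eqF.
  rewrite ler_piMr ?divr_ge0 ?mulr_ge0 // ler_pdivrMr // mul1r ler_nat; exact: lamk.
have lnk : ln d%:R <= 5 * kappa%:R :> R.
  by apply: le_trans lnd _; rewrite -natrM ler_nat; lia.
have : d%:R * kappa%:R <= 96 * q%:R :> R.
  move: total; rewrite -(ler_pM2l dR).
  have -> : d%:R * (16 * q%:R / d%:R + 16 * q%:R / d%:R) = 32 * q%:R :> R.
    by field; rewrite gt_eqF.
  by lra.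
by have := ler_wpM2l (ltW dR) lnk; lra.
Qed.

End Scales.

Unset Implicit Arguments.

(* Omega-notation in the two parameters n and d: one constant c serves all
   pairs (n, d) with n >= 2 and d >= 1, except finitely many. *)
Theorem theoremA2 (R : realType) :
  exists c : R, 0 < c /\ exists N : nat,
    forall n d q : nat, (2 <= n)%N -> (1 <= d)%N -> (N <= maxn n d)%N ->
    forall A : nonadaptive_algorithm R n d q,
    nonadaptive_unateness_tester A (1 / 8) ->
    c * (d%:R * (ln n%:R + ln d%:R)) <= q%:R.
Proof.
(* [ln n + ln d] is at most twice the larger logarithm, and 960 is twice the larger constant 480. *)
exists (1 / 960); split; first by lra.
exists (2 ^ 16)%N => n d q n2 d1 Nnd A HA.
have q0 : 0 <= q%:R :> R by [].
have n0 : (0 < n)%N by exact: leq_trans n2.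
have ln_mono (a b : nat) : (0 < a)%N -> (a <= b)%N -> ln a%:R <= ln b%:R :> R.
  by move=> a0 ab; rewrite ler_ln ?posrE ?ltr0n ?ler_nat // (leq_trans a0).
have dR : 0 <= d%:R :> R by [].
case: (leqP d n) => dn.
  have n16 : (2 ^ 16 <= n)%N by rewrite (maxn_idPl dn) in Nnd.
  have := @log_n_lower_bound R n d q A (leq_trans _ n16) HA => /(_ isT).
  by have := ler_wpM2l dR (ln_mono _ _ d1 dn); lra.
rewrite (maxn_idPr (ltnW dn)) in Nnd.
have := log_d_lower_bound n2 Nnd HA.
by have := ler_wpM2l dR (ln_mono _ _ n0 (ltnW dn)); lra.
Qed.
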